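(* Let $\mathcal{W}$ be a vertex operator algebra with a representation category $\mathrm{Rep}(\mathcal{W})$ as described in the context, and suppose that $\mathcal{W}$ has a finite number of irreducible representations $\mathcal{W}(a)$ (up to isomorphism) and that each $\mathcal{W}(a)$ has a projective cover $\mathcal{P}(a)$. Let $$\hat{\mathcal{H}}=\bigoplus_a \mathcal{P}(a)\otimes_{\mathbb{C}}\bar{\mathcal{P}}(a)^*,$$ where the sum runs over all irreducible representations, and let $\hat\beta=\bigoplus_a V_{ev_{\mathcal{P}(a)}}:\hat{\mathcal{H}}\to\mathcal{W}^*$ be the map compatible with the $\mathcal{W}$-symmetry whose restriction to the summand $\mathcal{P}(a)\otimes_{\mathbb{C}}\bar{\mathcal{P}}(a)^*$ is the one determined by the intertwining operator $V_{ev_{\mathcal{P}(a)}}$ of the canonical pairing $ev_{\mathcal{P}(a)}:\mathcal{P}(a)\otimes_f\mathcal{P}(a)^*\to\mathcal{W}^*$. Set $\mathcal{H}_{\mathrm{bulk}}=\hat{\mathcal{H}}/\ker(\hat\beta)$ and let $\beta_{\mathrm{bb}}:\mathcal{H}_{\mathrm{bulk}}\to\mathcal{W}^*$ be the map induced by $\hat\beta$ on the quotient. Consider the category whose objects are pairs $(\mathcal{H},\beta)$, where $\mathcal{H}$ is a $\mathcal{W}\otimes_{\mathbb{C}}\bar{\mathcal{W}}$-representation and $\beta:\mathcal{H}\to\mathcal{W}^*$ is a linear map compatible with the $\mathcal{W}$-symmetry (defined in the context), and whose arrows $(\mathcal{H},\beta)\to(\mathcal{H}',\beta')$ are the $\mathcal{W}\otimes_{\mathbb{C}}\bar{\mathcal{W}}$-intertwiners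 $f:\mathcal{H}\to\mathcal{H}'$ with $\beta'\circ f=\beta$. Then $(\mathcal{H}_{\mathrm{bulk}},\beta_{\mathrm{bb}})$ is a terminal object of this category: for every object $(\mathcal{H}',\beta')$ there is exactly one $\mathcal{W}\otimes_{\mathbb{C}}\bar{\mathcal{W}}$-intertwiner $g:\mathcal{H}'\to\mathcal{H}_{\mathrm{bulk}}$ such that $\beta'=\beta_{\mathrm{bb}}\circ g$.
   Context: Representations. $\mathrm{Rep}(\mathcal{W})$ is a category of (graded, possibly logarithmic, i.e. $L_0$ need not be diagonalisable) $\mathcal{W}$-representations; $\mathrm{Hom}(U,V)$ is the space of $\mathcal{W}$-intertwiners (module maps). Each $U$ has a conjugate (contragredient) representation $U^*$, defined on the graded dual of $U$; $(-)^*$ is a contravariant functor and there is a natural isomorphism $U\to U^{**}$. $\mathcal{W}^*$ is the conjugate of $\mathcal{W}$ viewed as a representation of itself; it need not be isomorphic to $\mathcal{W}$, and $\mathcal{W}$ need not be irreducible. $\Omega\in\mathcal{W}$ is the vacuum vector. $\bar{\mathcal{W}}$ is a second copy of $\mathcal{W}$, and a bar over a $\mathcal{W}$-representation indicates that it is regarded as a $\bar{\mathcal{W}}$-representation. Fusion. $\otimes_f$ denotes the fusion tensor product: for $R,S,U$ in $\mathrm{Rep}(\mathcal{W})$, the space of (logarithmic) intertwining operators $V(-,x):R\otimes_{\mathbb{C}}S\to U$ (with values in a suitable algebraic completion of $U$; the completion is suppressed from the notation throughout) is canonically isomorphic to $\mathrm{Hom}(R\otimes_f S,U)$. For $h\in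 \mathrm{Hom}(R\otimes_f S,U)$ the corresponding intertwining operator is written $V_h(-,x)$. Canonical pairing. There are isomorphisms $\mathrm{Hom}(U,V^* )\to\mathrm{Hom}(U\otimes_f V,\mathcal{W}^* )$, natural in $U$ and $V$. For each $U$, $ev_U:U\otimes_f U^*\to\mathcal{W}^*$ denotes the image of the natural isomorphism $U\to U^{**}$ under this isomorphism (with $V=U^*$). It is non-degenerate: for every nonzero $u\in U$ there is $u'\in U^*$ with $V_{ev_U}(u,x)u'\neq 0$, and vice versa. Maps compatible with the $\mathcal{W}$-symmetry. Fix $y>0$. Let $\mathcal{H}$ be a $\mathcal{W}\otimes_{\mathbb{C}}\bar{\mathcal{W}}$-representation and write it as a quotient $\mathcal{H}=\hat{\mathcal{K}}/Q$, where $\hat{\mathcal{K}}=\bigoplus_k M_k\otimes_{\mathbb{C}}\bar N_k$ with $M_k,N_k$ in $\mathrm{Rep}(\mathcal{W})$ and $Q$ is a sub-representation. For a linear map $\beta=\beta(-,y):\mathcal{H}\to\mathcal{W}^*$ (values in the algebraic completion), let $\beta_k$ be the composition $M_k\otimes_{\mathbb{C}}\bar N_k\hookrightarrow\hat{\mathcal{K}}\twoheadrightarrow\mathcal{H}\xrightarrow{\beta}\mathcal{W}^*$. The map $\beta$ is compatible with the $\mathcal{W}$-symmetry if for each $k$ there is an intertwining operator $V_{l,k}(-,x):M_k\otimes_{\mathbb{C}} N_k\to\mathcal{W}^*$ such that $$\beta_k(\phi\otimes_{\mathbb{C}}\phi',y)=V_{l,k}(\phi,iy)\,V_r(\phi',-iy)\Omega\qquad\text{for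 all }\phi\in M_k,\ \phi'\in N_k,$$ where $V_r(\phi',x)\Omega=e^{xL_{-1}}\phi'$ is translation by $x$. The right-hand side is understood as $e^{-iyL_{-1}}V_{l,k}(\phi,2iy)\phi'$, with a fixed choice of $\log(2iy)$. In particular the space of possible maps $\beta_k$ is isomorphic to $\mathrm{Hom}(M_k\otimes_f N_k,\mathcal{W}^* )$. The map $\hat\beta$ in the claim is given on the summand $\mathcal{P}(a)\otimes_{\mathbb{C}}\bar{\mathcal{P}}(a)^*$ by this formula with $V_{l}=V_{ev_{\mathcal{P}(a)}}$. Standing assumption on representations. Every $\mathcal{W}\otimes_{\mathbb{C}}\bar{\mathcal{W}}$-representation $\mathcal{H}'$ under consideration can be written as $\mathcal{H}'=\hat{\mathcal{H}}'/Q'$ with $\hat{\mathcal{H}}'=\bigoplus_{a,b}N_{ab}\,\mathcal{P}(a)\otimes_{\mathbb{C}}\bar{\mathcal{P}}(b)$ for some multiplicities $N_{ab}$ and a sub-representation $Q'$. *)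

(* Defs.v *)
(* R is an arbitrary realType; the complex numbers are R[i]. *)
From HB Require Import structures.
From mathcomp Require Import all_boot all_order all_algebra.
From mathcomp Require Import generic_quotient complex.
From mathcomp Require Import boolp classical_sets functions cardinality fsbigop.
From mathcomp Require Import reals sequences exp trigo.
From mathcomp.multinomials Require Import freeg.

Set Implicit Arguments.
Unset Strict Implicit.
Unset Printing Implicit Defensive.

Import Order.TTheory GRing.Theory Num.Theory.

Local Open Scope classical_set_scope.
Local Open Scope complex_scope.
Local Open Scope ring_scope.
Local Open Scope quotient_scope.

(* Sums [\sum_(i \in [set: nat]) F i] range over the support of F, which is
   finite in every use below (by truncation, or by lower boundedness of the
   conformal weights). *)

Section LinearAlgebra.
Variable R : realType.
Local Notation C := R[i].

Definition cexp (z : C) : C :=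
  (expR (complex.Re z))%:C * (cos (complex.Im z) +i* sin (complex.Im z)).

Definition gbinom (x : C) (i : nat) : C :=
  (\prod_(j < i) (x - j%:R)) / (i`!)%:R.

Definition gen_eigen (V : lmodType C) (T : V -> V) (a : C) (v : V) : Prop :=
  exists k, iter k (fun x => T x - a *: x) v = 0.

Definition fin_dim (V : lmodType C) (E : V -> Prop) : Prop :=
  exists s : seq V, forall v, E v ->
    exists c : nat -> C, v = \sum_(i < size s) c i *: s`_i.

Record submodule (V : lmodType C) (K : V -> Prop) : Prop := Submodule {
  submod0 : K 0;
  submodL : forall a x y, K x -> K y -> K (a *: x + y) }.

Definition eventually0 (V : lmodType C) (F : nat -> V) : Prop :=
  exists N, forall i, (N <= i)%N -> F i = 0.

Lemma fsum_nat (V : lmodType C) (F : nat -> V) N :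
  (forall i, (N <= i)%N -> F i = 0) ->
  \sum_(i \in [set: nat]) F i = \sum_(i < N) F i.
Proof.
move=> F0; rewrite (@fsbigE _ _ _ _ _ (iota 0 N)) ?iota_uniq //; last first.
  by move=> i _; rewrite mem_iota /= add0n -leqNgt => /F0.
rewrite (eq_bigl xpredT); last by move=> i; rewrite in_setT.
by rewrite -{1}[N]subn0 -/(index_iota 0 N) big_mkord.
Qed.

Lemma linZ (V U : lmodType C) (f : V -> U) :
  linear f -> forall a x, f (a *: x) = a *: f x.
Proof.
move=> lf a x; have f0 : f 0 = 0.
  by have := lf (-1) 0 0; rewrite scaler0 addr0 scaleN1r addNr.
by have := lf a x 0; rewrite f0 !addr0.
Qed.

Lemma lin0 (V U : lmodType C) (f : V -> U) : linear f -> f 0 = 0.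
Proof. by move=> lf; have := linZ lf 0 0; rewrite !scale0r. Qed.

Lemma linD (V U : lmodType C) (f : V -> U) :
  linear f -> forall x y, f (x + y) = f x + f y.
Proof. by move=> lf x y; have := lf 1 x y; rewrite !scale1r. Qed.

Lemma linN (V U : lmodType C) (f : V -> U) :
  linear f -> forall x, f (- x) = - f x.
Proof. by move=> lf x; rewrite -scaleN1r (linZ lf) scaleN1r. Qed.

Lemma fsum_lin (V U : lmodType C) (f : V -> U) (F : nat -> V) :
  linear f -> eventually0 F ->
  f (\sum_(i \in [set: nat]) F i) = \sum_(i \in [set: nat]) f (F i).
Proof.
move=> lf [N F0].
rewrite (fsum_nat F0) (@fsum_nat _ _ N); last by move=> i /F0 ->; exact: lin0.
elim/big_ind2: _ => [|x1 x2 y1 y2 <- <-|] //; first exact: lin0.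
exact: linD.
Qed.

Lemma fsumD (V : lmodType C) (F G : nat -> V) :
  eventually0 F -> eventually0 G ->
  \sum_(i \in [set: nat]) (F i + G i) =
  \sum_(i \in [set: nat]) F i + \sum_(i \in [set: nat]) G i.
Proof.
move=> [N F0] [N' G0].
have F0' i : (maxn N N' <= i)%N -> F i = 0 by rewrite geq_max => /andP[/F0].
have G0' i : (maxn N N' <= i)%N -> G i = 0 by rewrite geq_max => /andP[_ /G0].
rewrite (fsum_nat F0') (fsum_nat G0') (@fsum_nat _ _ (maxn N N')) ?big_split //.
by move=> i Hi; rewrite F0' // G0' // addr0.
Qed.

Section Quotient.
Variables (V : lmodType C) (K : V -> Prop) (HK : submodule K).

Definition qrel : rel V := fun x y => `[< K (x - y) >].

Lemma subK x y : K x -> K y -> K (x - y).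
Proof. by move=> Kx Ky; have := submodL HK (-1) Ky Kx; rewrite scaleN1r addrC. Qed.

Lemma subKZ a x : K x -> K (a *: x).
Proof. by move=> Kx; have := submodL HK a Kx (submod0 HK); rewrite addr0. Qed.

Lemma subKD x y : K x -> K y -> K (x + y).
Proof. by move=> Kx Ky; have := submodL HK 1 Kx Ky; rewrite scale1r. Qed.

Lemma qrel_equiv : equiv_class_of qrel.
Proof.
split=> [x|x y|y x z]; rewrite /qrel.
- by rewrite subrr; apply/asboolP/(submod0 HK).
- by apply/asboolP/asboolP => H; rewrite -opprB -sub0r;
    apply: subK => //; exact: (submod0 HK).
- by move=> /asboolP H1 /asboolP H2; apply/asboolP;
    have := subKD H1 H2; rewrite addrA subrK.
Qed.

Canonical qequiv := EquivRelPack qrel_equiv.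

Definition quot := {eq_quot qequiv}.
HB.instance Definition _ := Choice.on quot.

Definition qpi (x : V) : quot := \pi_quot x.
Definition qrepr (q : quot) : V := repr q.

Lemma qpiP x y : qpi x = qpi y <-> K (x - y).
Proof.
split.
  by move=> /eqmodP; rewrite /= /qrel => /asboolP.
by move=> H; apply/eqmodP; apply/asboolP.
Qed.

Lemma qreprK q : qpi (qrepr q) = q. Proof. exact: reprK. Qed.

Lemma qpiK x : K (qrepr (qpi x) - x).
Proof. by apply/qpiP; rewrite qreprK. Qed.

Definition qadd (p q : quot) : quot := qpi (qrepr p + qrepr q).
Definition qopp (p : quot) : quot := qpi (- qrepr p).
Definition qscale (a : C) (p : quot) : quot := qpi (a *: qrepr p).

Lemma qaddE x y : qadd (qpi x) (qpi y) = qpi (x + y).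
Proof. by apply/qpiP; rewrite opprD addrACA; apply: subKD; exact: qpiK. Qed.

Lemma qscaleE a x : qscale a (qpi x) = qpi (a *: x).
Proof. by apply/qpiP; rewrite -scalerBr; apply: subKZ; exact: qpiK. Qed.

Lemma qoppE x : qopp (qpi x) = qpi (- x).
Proof.
by rewrite -scaleN1r -qscaleE /qscale scaleN1r.
Qed.

Lemma qaddA : associative qadd.
Proof.
by move=> x y z; rewrite -(qreprK x) -(qreprK y) -(qreprK z) !qaddE addrA.
Qed.
Lemma qaddC : commutative qadd.
Proof. by move=> x y; rewrite -(qreprK x) -(qreprK y) !qaddE addrC. Qed.
Lemma qadd0 : left_id (qpi 0) qadd.
Proof. by move=> x; rewrite -(qreprK x) !qaddE add0r. Qed.
Lemma qaddN : left_inverse (qpi 0) qopp qadd.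
Proof. by move=> x; rewrite -(qreprK x) qoppE qaddE addNr. Qed.

HB.instance Definition _ := GRing.isZmodule.Build quot qaddA qaddC qadd0 qaddN.

Lemma qpiD x y : qpi (x + y) = qpi x + qpi y. Proof. by rewrite -qaddE. Qed.

Lemma qscaleA a b x : qscale a (qscale b x) = qscale (a * b) x.
Proof. by rewrite -(qreprK x) !qscaleE scalerA. Qed.
Lemma qscale1 : left_id 1 qscale.
Proof. by move=> x; rewrite -(qreprK x) !qscaleE scale1r. Qed.
Lemma qscaleDr : right_distributive qscale +%R.
Proof.
by move=> a x y; rewrite -(qreprK x) -(qreprK y) -qpiD !qscaleE scalerDr qpiD.
Qed.
Lemma qscaleDl x : {morph qscale^~ x : a b / a + b}.
Proof. by move=> a b; rewrite -(qreprK x) !qscaleE scalerDl qpiD. Qed.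

HB.instance Definition _ := GRing.Zmodule_isLmodule.Build C quot
  qscaleA qscale1 qscaleDr qscaleDl.

Lemma qpi_linear : linear qpi.
Proof. by move=> a x y; rewrite qpiD -qscaleE. Qed.

(* The map induced on the quotient by f, when f is constant on cosets. *)
Definition quot_map (U : Type) (f : V -> U) (q : quot) : U := f (qrepr q).

Lemma quot_mapE (U : lmodType C) (f : V -> U) :
  linear f -> (forall x, K x -> f x = 0) ->
  forall x, quot_map f (qpi x) = f x.
Proof.
move=> lf f0 x; have := f0 _ (qpiK x).
rewrite addrC -scaleN1r lf scaleN1r addrC => /eqP.
by rewrite subr_eq0 => /eqP.
Qed.

End Quotient.

(* The direct sum over k of M k \otimes_C N k, by generators (k, (m, n)) and
   the bilinearity relations. *)
Section SumTensor.
Variables (I : choiceType) (M N : I -> lmodType C).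

Definition symbol := {k : I & (M k * N k)%type}.
HB.instance Definition _ := Choice.on symbol.
Definition sym (k : I) (m : M k) (n : N k) : symbol :=
  Tagged (fun k => (M k * N k)%type) (m, n).

Local Notation free := {freeg symbol / C}.

Definition bilinear_relator (x : free) : Prop :=
  (exists k a (m m' : M k) (n : N k),
     x = << sym (a *: m + m') n >> - a *: << sym m n >> - << sym m' n >>) \/
  (exists k a (m : M k) (n n' : N k),
     x = << sym m (a *: n + n') >> - a *: << sym m n >> - << sym m n' >>).

Definition bilinear_relations (x : free) : Prop :=
  forall K : free -> Prop, submodule K ->
    (forall z, bilinear_relator z -> K z) -> K x.

Lemma bilinear_relations_submod : submodule bilinear_relations.
Proof.
split=> [K HK _|a x y Hx Hy K HK HR]; first exact: submod0 HK.
by apply: (submodL HK); [exact: Hx|exact: Hy].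
Qed.

Definition sum_tensor := quot bilinear_relations_submod.
HB.instance Definition _ := GRing.Lmodule.on sum_tensor.

Definition tens (k : I) (m : M k) (n : N k) : sum_tensor :=
  qpi bilinear_relations_submod << sym m n >>.

Lemma tens_linl k (n : N k) : linear (fun m : M k => tens m n).
Proof.
move=> a m m'; rewrite /tens -qpi_linear; apply/qpiP => K HK HR; apply: HR.
by left; exists k, a, m, m', n; rewrite opprD addrA.
Qed.

Lemma tens_linr k (m : M k) : linear (fun n : N k => tens m n).
Proof.
move=> a n n'; rewrite /tens -qpi_linear; apply/qpiP => K HK HR; apply: HR.
by right; exists k, a, m, n, n'; rewrite opprD addrA.
Qed.

Lemma sum_tensor_ind (P : sum_tensor -> Prop) :
  P 0 -> (forall x y, P x -> P y -> P (x + y)) ->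
  (forall k (m : M k) (n : N k), P (tens m n)) -> forall x, P x.
Proof.
move=> P0 PD PT x; rewrite -(qreprK x) -(freeg_sumE (qrepr x)).
elim: (dom _) => [|z s IH]; first by rewrite big_nil.
rewrite big_cons qpiD; apply: PD => //.
have -> : << coeff z (qrepr x) *g z >> = coeff z (qrepr x) *: << z >> :> free.
  by apply/eqP/freeg_eqP => t; rewrite coeffZ !coeffU mul1r.
rewrite (linZ (@qpi_linear _ _ bilinear_relations_submod)).
case: z (coeff _ _) => k [m n] c.
rewrite -[qpi _ _]/(tens m n) -(linZ (tens_linl n)); exact: PT.
Qed.

(* The linear extension of a family of bilinear maps. *)
Definition sum_tensor_lift (U : lmodType C) (f : forall k, M k -> N k -> U) :
  sum_tensor -> U :=
  quot_map (fglift (fun z => f (tag z) (tagged z).1 (tagged z).2)).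

Section Lift.
Variables (U : lmodType C) (f : forall k, M k -> N k -> U).
Hypothesis fl : forall k (n : N k), linear (fun m => f m n).
Hypothesis fr : forall k (m : M k), linear (f m).

Let g (z : symbol) := f (tagged z).1 (tagged z).2.

Lemma fglift_linear : linear (fglift g).
Proof.
have gD x y : fglift g (x + y) = fglift g x + fglift g y.
  have gB := lift_is_additive g.
  have g0 : fglift g 0 = 0 by rewrite -[0 in LHS](subrr 0) gB subrr.
  by rewrite -{1}[y]opprK gB -[- y in LHS]sub0r gB g0 sub0r opprK.
move=> a x y; rewrite gD; congr (_ + _).
have g0 : fglift g 0 = 0.
  by apply: (addrI (fglift g 0)); rewrite -gD !addr0.
have gS (s : seq symbol) (F : symbol -> free) :
    fglift g (\sum_(z <- s) F z) = \sum_(z <- s) fglift g (F z).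
  by elim: s => [|z s IH]; rewrite ?big_nil // !big_cons gD IH.
have -> : a *: x = \sum_(z <- dom x) << a * coeff z x *g z >> by [].
rewrite -[in RHS](freeg_sumE x) !gS scaler_sumr.
by apply: eq_bigr => z _; rewrite !liftU scalerA.
Qed.

Lemma fglift_rel x : bilinear_relations x -> fglift g x = 0.
Proof.
have gl := fglift_linear.
move/(_ (fun x => fglift g x = 0)); apply=> [|z].
  split; first exact: (lin0 gl).
  by move=> a x' y' Hx Hy; rewrite gl Hx Hy scaler0 addr0.
move=> [[k [a [m [m' [n ->]]]]]|[k [a [m [n [n' ->]]]]]].
  rewrite !(linD gl) !(linN gl) (linZ gl) !liftU !scale1r /g /= (fl n a m m').
  by rewrite addrAC addrK subrr.
rewrite !(linD gl) !(linN gl) (linZ gl) !liftU !scale1r /g /= (fr m a n n').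
by rewrite addrAC addrK subrr.
Qed.

Lemma sum_tensor_liftE k (m : M k) (n : N k) :
  sum_tensor_lift f (tens m n) = f m n.
Proof.
rewrite /sum_tensor_lift /tens quot_mapE; first by rewrite liftU scale1r.
  exact: fglift_linear.
exact: fglift_rel.
Qed.

Lemma sum_tensor_lift_linear : linear (sum_tensor_lift f).
Proof.
move=> a x y; rewrite -(qreprK x) -(qreprK y) -qpi_linear /sum_tensor_lift.
rewrite !quot_mapE; first exact: fglift_linear.
all: solve [exact: fglift_linear | exact: fglift_rel].
Qed.
End Lift.

End SumTensor.

End LinearAlgebra.

(* A vertex operator is written through its modes,
   Y(u, x) = \sum_n u_n x^(-n-1), with n : int.  The Jacobi identity is stated
   in its component form, the Borcherds identity. *)
Section VOA.
Variable R : realType.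
Local Notation C := R[i].

Definition borcherds (V M : lmodType C) (Y : V -> int -> V -> V)
    (act : V -> int -> M -> M) : Prop :=
  forall (u v : V) (l m n : int) (x : M),
    \sum_(i \in [set: nat])
       gbinom m%:~R i *: act (Y u (l + i%:Z) v) (m + n - i%:Z) x =
    \sum_(i \in [set: nat]) ((-1) ^+ i * gbinom l%:~R i) *:
       (act u (m + l - i%:Z) (act v (n + i%:Z) x)
        - (-1) ^ l *: act v (n + l - i%:Z) (act u (m + i%:Z) x)).

(* L_n = omega_(n+1) for the conformal vector omega. *)
Record voa := Voa {
  voa_space :> lmodType C;
  vmode : voa_space -> int -> voa_space -> voa_space;
  vacuum : voa_space;
  conf : voa_space;
  central_charge : C;
  vmode_linl : forall n v, linear (fun u => vmode u n v);
  vmode_linr : forall u n, linear (vmode u n);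
  vmode_trunc : forall u v, exists N : int, forall n, N <= n -> vmode u n v = 0;
  vacuum_mode : forall n v, vmode vacuum n v = if n == -1 then v else 0;
  creation : forall u, vmode u (-1) vacuum = u;
  creation_reg : forall u n, 0 <= n -> vmode u n vacuum = 0;
  vmode_borcherds : borcherds vmode vmode;
  virasoro : forall (m n : int) v,
    vmode conf (m + 1) (vmode conf (n + 1) v)
      - vmode conf (n + 1) (vmode conf (m + 1) v) =
    (m - n)%:~R *: vmode conf (m + n + 1) v
      + (if m + n == 0 then (m ^+ 3 - m)%:~R / 12 * central_charge else 0) *: v;
  vmode_deriv : forall u n v,
    vmode (vmode conf 0 u) n v = - n%:~R *: vmode u (n - 1) v;
  vgraded : forall v, exists s : seq (int * voa_space),
    (forall p, p \in s -> vmode conf 1 p.2 = p.1%:~R *: p.2) /\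
    v = \sum_(p <- s) p.2;
  vfindim : forall n : int, fin_dim (fun v => vmode conf 1 v = n%:~R *: v);
  vlower : exists N : int, forall n v,
    n < N -> vmode conf 1 v = n%:~R *: v -> v = 0 }.

Section Modules.
Variable W : voa.

Record weak_module (M : lmodType C) (act : W -> int -> M -> M) : Prop :=
  WeakModule {
  act_linl : forall n x, linear (fun u => act u n x);
  act_linr : forall u n, linear (act u n);
  act_trunc : forall u x, exists N : int, forall n, N <= n -> act u n x = 0;
  act_vacuum : forall n x, act (vacuum W) n x = if n == -1 then x else 0;
  act_borcherds : borcherds (@vmode W) act }.

(* Every vector is a sum of generalized eigenvectors of L_0. *)
Definition graded (M : lmodType C) (act : W -> int -> M -> M) : Prop :=
  forall x, exists s : seq (C * M),
    (forall p, p \in s -> gen_eigen (act (conf W) 1) p.1 p.2) /\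
    x = \sum_(p <- s) p.2.

(* Possibly logarithmic representations: L_0 need not be diagonalisable, its
   generalized eigenspaces are finite-dimensional (so that U^** is U) and the
   weights in each coset of the integers are bounded below. *)
Record wmod := Wmod {
  wspace :> lmodType C;
  wact : W -> int -> wspace -> wspace;
  wact_weak : weak_module wact;
  wgraded : graded wact;
  wfindim : forall a, fin_dim (gen_eigen (wact (conf W) 1) a);
  wlower : forall a, exists N : nat, forall n, (N <= n)%N ->
    forall x, gen_eigen (wact (conf W) 1) (a - n%:R) x -> x = 0 }.

Definition weight_space (M : wmod) (a : C) : M -> Prop :=
  gen_eigen (wact (conf W) 1) a.

(* The component of x in the generalized eigenspace of weight a; it does not
   depend on the chosen decomposition of x. *)
Definition wcomp (M : wmod) (a : C) (x : M) : M :=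
  \sum_(p <- projT1 (cid (wgraded x)) | p.1 == a) p.2.

Record whom (M N : wmod) := Whom {
  whom_fun :> {linear M -> N};
  whomE : forall w n x, whom_fun (wact w n x) = wact w n (whom_fun x) }.

Program Definition wcompose (M N P : wmod) (g : whom N P) (f : whom M N) :
  whom M P := @Whom M P (whom_fun g \o whom_fun f) _.
Next Obligation. by move=> M N P g f w n x /=; rewrite !whomE. Qed.

Section Adjoint.

Let T := @vmode W (conf W) 1.
Let Tl : linear T := @vmode_linr W (conf W) 1.

Lemma foldr_eigen (s : seq (int * W)) (a : C) v : T v = a *: v ->
  foldr (fun p x => T x - p.1%:~R *: x) v s = (\prod_(p <- s) (a - p.1%:~R)) *: v.
Proof.
move=> Tv; elim: s => [|p s IH] /=; first by rewrite big_nil scale1r.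
by rewrite IH (linZ Tl) Tv !scalerA big_cons -scalerBl mulrBl (mulrC a).
Qed.

Lemma foldr_sum (s t : seq (int * W)) :
  foldr (fun p x => T x - p.1%:~R *: x) (\sum_(q <- t) q.2) s =
  \sum_(q <- t) foldr (fun p x => T x - p.1%:~R *: x) q.2 s.
Proof.
elim: s => [|p s IH] //=; rewrite IH.
elim: t {IH} => [|q t IH]; first by rewrite !big_nil (lin0 Tl) scaler0 subr0.
by rewrite !big_cons (linD Tl) -IH scalerDr opprD addrACA.
Qed.

Lemma eigen_sum0 (s : seq (int * W)) (a : C) v :
  (forall p, p \in s -> T p.2 = p.1%:~R *: p.2) ->
  (forall p, p \in s -> p.1%:~R != a) ->
  v = \sum_(p <- s) p.2 -> T v = a *: v -> v = 0.
Proof.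
move=> sT sa vE Tv; have := foldr_eigen s Tv.
rewrite {1}vE foldr_sum big_seq big1 => [/esym/eqP|p ps].
  rewrite scaler_eq0 => /orP[|/eqP //].
  rewrite prodf_seq_eq0 => /hasP[p ps /=].
  by rewrite subr_eq0 eq_sym (negbTE (sa p ps)).
rewrite (foldr_eigen s (sT _ ps)) (big_rem p) //= subrr mul0r.
by rewrite scale0r.
Qed.

Lemma gen_eigen_adj (a : C) v : gen_eigen T a v -> T v = a *: v.
Proof.
move=> [k]; elim: k v => [|k IH] v /= Hv.
  by rewrite Hv (lin0 Tl) scaler0.
have Hu : T (T v - a *: v) = a *: (T v - a *: v).
  apply: IH; by rewrite -iterSr.
have [s [sT' vE]] := vgraded v.
have sT p : p \in s -> T p.2 = p.1%:~R *: p.2 := sT' p.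
apply/eqP; rewrite -subr_eq0; apply/eqP.
pose t := [seq (p.1, (p.1%:~R - a) *: p.2) | p <- s & p.1%:~R != a].
apply: (@eigen_sum0 t a _) Hu => [p|p|].
- case/mapP => q; rewrite mem_filter => /andP[_ qs] -> /=.
  by rewrite (linZ Tl) sT // scalerA mulrC -scalerA.
- by case/mapP => q; rewrite mem_filter => /andP[qa _] ->.
rewrite big_map big_filter /=.
have -> : T v - a *: v = \sum_(p <- s) (p.1%:~R - a) *: p.2.
  have -> : T v = \sum_(p <- s) T p.2.
    rewrite vE; elim: (s) => [|q r IHr]; first by rewrite !big_nil (lin0 Tl).
    by rewrite !big_cons (linD Tl) IHr.
  rewrite {1}vE scaler_sumr -sumrB big_seq [RHS]big_seq.
  by apply: eq_bigr => p /sT ->; rewrite scalerBl.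
rewrite [RHS]big_mkcond; apply: eq_bigr => p _.
by case: eqP => //= ->; rewrite subrr scale0r.
Qed.

Lemma weight_adj (a : C) v : gen_eigen T a v -> v != 0 ->
  exists n : int, a = n%:~R /\ T v = n%:~R *: v.
Proof.
move=> /gen_eigen_adj Tv v0; have [s [sT vE]] := vgraded v.
case: (pselect (exists n : int, a = n%:~R)) => [[n an]|na].
  by exists n; rewrite -an.
case/eqP: v0; apply: (eigen_sum0 sT _ vE Tv) => p _.
by apply/eqP => pa; apply: na; exists p.1.
Qed.

Lemma adj_weak : weak_module (@vmode W).
Proof.
split; [exact: vmode_linl|exact: vmode_linr|exact: vmode_trunc
       |exact: vacuum_mode|exact: vmode_borcherds].
Qed.

Lemma adj_graded : graded (@vmode W).
Proof.
move=> v; have [s [sT ->]] := vgraded v.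
exists [seq (p.1%:~R, p.2) | p <- s]; split; last by rewrite big_map.
move=> _ /mapP[p ps ->] /=; exists 1%N => /=.
by rewrite sT // subrr.
Qed.

Lemma adj_findim a : fin_dim (gen_eigen T a).
Proof.
case: (pselect (exists n : int, a = n%:~R)) => [[n ->]|na].
  have [s sP] := vfindim W n; exists s => v /gen_eigen_adj; exact: sP.
exists [::] => v Hv; exists (fun=> 0); rewrite big_ord0.
case: (eqVneq v 0) => // /(weight_adj Hv) [n [an _]].
by case: na; exists n.
Qed.

Lemma adj_lower a : exists N : nat, forall n, (N <= n)%N ->
  forall v, gen_eigen T (a - n%:R) v -> v = 0.
Proof.
have [N HN] := vlower W.
case: (pselect (exists n : int, a = n%:~R)) => [[n an]|na]; last first.
  exists 0%N => n _ v Hv; case: (eqVneq v 0) => // /(weight_adj Hv) [m [am _]].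
  case: na; exists (m + n%:Z); rewrite rmorphD /= -am.
  by rewrite -[n%:~R]/(n%:R) subrK.
exists `|n - N|.+1%N => k Hk v Hv.
case: (eqVneq v 0) => // /(weight_adj Hv) [m [am Tv]].
apply: (HN m) Tv.
have -> : m = n - k%:Z.
  by apply: (@intr_inj C); rewrite -am an rmorphB.
rewrite ltrBlDr -ltrBlDl; apply: le_lt_trans (ler_norm _) _.
by rewrite -abszE ltz_nat.
Qed.

(* W as a representation of itself. *)
Definition adj : wmod := Wmod adj_weak adj_graded adj_findim adj_lower.

End Adjoint.

(* Logarithmic intertwining operators
     V(u, x) v = \sum_(n : C, k : nat) u_(n; k) v x^(-n-1) (log x)^k;
   [iop u n k v] is u_(n; k) v.  The axioms are lower truncation, finiteness of
   the powers of log x, the Jacobi identity (log x is a spectator in it) and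
   V(L_(-1) u, x) = d/dx V(u, x). *)
Record intop (A B U : wmod) := Intop {
  iop :> A -> C -> nat -> B -> U;
  iop_linl : forall n k v, linear (fun u => iop u n k v);
  iop_linr : forall u n k, linear (iop u n k);
  iop_trunc : forall u v n, exists N : nat, forall i, (N <= i)%N ->
    forall k, iop u (n + i%:R) k v = 0;
  iop_log : forall u v n, exists K : nat, forall k, (K <= k)%N ->
    iop u n k v = 0;
  iop_jacobi : forall (w : W) (u : A) (l m : int) (n : C) (k : nat) (v : B),
    \sum_(i \in [set: nat])
       gbinom m%:~R i *: iop (wact w (l + i%:Z) u) (m%:~R + n - i%:R) k v =
    \sum_(i \in [set: nat]) ((-1) ^+ i * gbinom l%:~R i) *:
       (wact w (m + l - i%:Z) (iop u (n + i%:R) k v)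
        - (-1) ^ l *: iop u (n + l%:~R - i%:R) k (wact w (m + i%:Z) v));
  iop_deriv : forall u n k v,
    iop (wact (conf W) 0 u) n k v =
      - n *: iop u (n - 1) k v + k.+1%:R *: iop u (n - 1) k.+1 v }.

Section RepCategory.
Variable Rep : wmod -> Prop.

Record robj := RObj { rmod :> wmod; robjP : Rep rmod }.

(* [cpair] identifies [cobj U] with the graded dual of U (the functionals that
   vanish on all but finitely many weight spaces), and [cpair_inv] is
   <Y(v, x) u', u> = <u', Y(e^(x L_1) (- x^-2)^(L_0) v, x^-1) u> in modes, for v
   of weight h.  These determine [cobj U] and the transpose [cmap f]. *)
Record conjugation := Conjugation {
  cobj : robj -> robj;
  cpair : forall U : robj, cobj U -> U -> C;
  cpair_linl : forall (U : robj) (u : U),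
    linear (fun u' : cobj U => cpair u' u : C^o);
  cpair_linr : forall (U : robj) (u' : cobj U),
    linear (fun u : U => cpair u' u : C^o);
  cpair_inj : forall (U : robj) (u' : cobj U),
    (forall u, cpair u' u = 0) -> u' = 0;
  cpair_dual : forall (U : robj) (phi : {scalar U}),
    (exists s : seq C, forall a, a \notin s ->
       forall u : U, weight_space a u -> phi u = 0) <->
    (exists u' : cobj U, forall u, cpair u' u = phi u);
  cpair_inv : forall (U : robj) (h : int) (v : W),
    vmode (conf W) 1 v = h%:~R *: v ->
    forall (n : int) (u' : cobj U) (u : U),
    cpair (wact v n u') u =
      (-1) ^ h * \sum_(j \in [set: nat]) (j`!)%:R^-1 *
        cpair u' (wact (iter j (vmode (conf W) 2) v)
                       (h + h - j%:Z - n - 2) u);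
  cmap : forall U V : robj, whom U V -> whom (cobj V) (cobj U);
  cmapE : forall (U V : robj) (f : whom U V) (v' : cobj V) (u : U),
    cpair (cmap f v') u = cpair v' (f u);
  cbidual : forall U : robj, whom U (cobj (cobj U));
  cbidual_bij : forall U : robj, bijective (cbidual U);
  cbidual_nat : forall (U V : robj) (f : whom U V) (u : U),
    cbidual V (f u) = cmap (cmap f) (cbidual U u) }.

(* [fop] is the canonical isomorphism h |-> V_h from Hom(R \otimes_f S, U) onto
   the intertwining operators of type (U; R S).  Its naturality in R and S is
   what [fmap], the tensor product of intertwiners, is defined by. *)
Record fusion := Fusion {
  fobj : robj -> robj -> robj;
  fmap : forall R R' S S' : robj,
    whom R R' -> whom S S' -> whom (fobj R S) (fobj R' S');
  fop : forall R S U : robj, whom (fobj R S) U -> intop R S U;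
  fop_lin : forall (R S U : robj) (c : C) (h1 h2 h : whom (fobj R S) U),
    (forall x, h x = c *: h1 x + h2 x) ->
    forall u n k v, fop h u n k v = c *: fop h1 u n k v + fop h2 u n k v;
  fop_inj : forall (R S U : robj) (h h' : whom (fobj R S) U),
    (forall u n k v, fop h u n k v = fop h' u n k v) -> h =1 h';
  fop_surj : forall (R S U : robj) (Y : intop R S U),
    exists h : whom (fobj R S) U, forall u n k v, fop h u n k v = Y u n k v;
  fop_nat : forall (R S U U' : robj) (g : whom U U') (h : whom (fobj R S) U)
    u n k v, fop (wcompose g h) u n k v = g (fop h u n k v);
  fop_natRS : forall (R R' S S' U : robj) (f : whom R R') (g : whom S S')
    (h : whom (fobj R' S') U) u n k v,
    fop (wcompose h (fmap f g)) u n k v = fop h (f u) n k (g v) }.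

Section Pairing.
Variables (RW : Rep adj) (cj : conjugation) (fu : fusion).

(* The conjugate W^* of W. *)
Definition dualW : robj := cobj cj (RObj RW).

Record canonical_pairing := CanonicalPairing {
  cp : forall U V : robj, whom U (cobj cj V) -> whom (fobj fu U V) dualW;
  cp_lin : forall (U V : robj) (c : C) (h1 h2 h : whom U (cobj cj V)),
    (forall x, h x = c *: h1 x + h2 x) ->
    forall x, cp h x = c *: cp h1 x + cp h2 x;
  cp_inj : forall (U V : robj) (h h' : whom U (cobj cj V)),
    cp h =1 cp h' -> h =1 h';
  cp_surj : forall (U V : robj) (b : whom (fobj fu U V) dualW),
    exists h : whom U (cobj cj V), cp h =1 b;
  cp_nat : forall (U U' V V' : robj) (f : whom U' U) (g : whom V' V)
    (h : whom U (cobj cj V)),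
    cp (wcompose (cmap cj g) (wcompose h f)) =1 wcompose (cp h) (fmap fu f g) }.

Definition ev (pr : canonical_pairing) (U : robj) :
  whom (fobj fu U (cobj cj U)) dualW := cp pr (cbidual cj U).

Definition ev_nondegenerate (pr : canonical_pairing) : Prop :=
  forall U : robj,
    (forall u : U, u != 0 -> exists (u' : cobj cj U) n k,
       fop (ev pr U) u n k u' != 0) /\
    (forall u' : cobj cj U, u' != 0 -> exists (u : U) n k,
       fop (ev pr U) u n k u' != 0).

End Pairing.

Definition wsurjective (M N : wmod) (f : whom M N) : Prop :=
  forall y, exists x, f x = y.

Definition irreducible (M : wmod) : Prop :=
  (exists x : M, x != 0) /\
  forall K : M -> Prop, submodule K ->
    (forall w n x, K x -> K (wact w n x)) ->
    (forall x, K x -> x = 0) \/ (forall x, K x).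

Definition isomorphic (M N : wmod) : Prop :=
  exists f : whom M N, bijective f.

Definition projective (P : robj) : Prop :=
  forall (M N : robj) (q : whom M N) (f : whom P N), wsurjective q ->
    exists g : whom P M, wcompose q g =1 f.

(* p exhibits P as a projective cover of M in Rep(W). *)
Definition projective_cover (P M : robj) (p : whom P M) : Prop :=
  [/\ projective P, wsurjective p &
      forall (X : robj) (f : whom X P),
        wsurjective (wcompose p f) -> wsurjective f].

End RepCategory.

(* W \otimes_C \bar W-representations: two commuting actions of W. *)
Record bimod := Bimod {
  bspace :> lmodType C;
  actl : W -> int -> bspace -> bspace;
  actr : W -> int -> bspace -> bspace;
  actl_weak : weak_module actl;
  actr_weak : weak_module actr;
  actlrC : forall u m v n x, actl u m (actr v n x) = actr v n (actl u m x);
  actl_graded : graded actl;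
  actr_graded : graded actr }.

Record bihom (H H' : bimod) := Bihom {
  bihom_fun :> {linear H -> H'};
  bihom_l : forall w n x, bihom_fun (actl w n x) = actl w n (bihom_fun x);
  bihom_r : forall w n x, bihom_fun (actr w n x) = actr w n (bihom_fun x) }.

Definition bisurjective (H H' : bimod) (f : bihom H H') : Prop :=
  forall y, exists x, f x = y.

Record subrep (H : bimod) (K : H -> Prop) : Prop := Subrep {
  subrep_submod : submodule K;
  subrep_l : forall w n x, K x -> K (actl w n x);
  subrep_r : forall w n x, K x -> K (actr w n x) }.

Section Transport.

Lemma linear_sum (V U : lmodType C) (f : V -> U) (I : Type) (s : seq I)
    (F : I -> V) : linear f -> f (\sum_(i <- s) F i) = \sum_(i <- s) f (F i).
Proof.
move=> fl; elim: s => [|i s IH]; first by rewrite !big_nil (lin0 fl).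
by rewrite !big_cons (linD fl) IH.
Qed.

Lemma gen_eigen_map (V U : lmodType C) (T : V -> V) (S : U -> U) (f : V -> U) a x :
  linear f -> (forall x, f (T x) = S (f x)) ->
  gen_eigen T a x -> gen_eigen S a (f x).
Proof.
move=> fl fT [k Hk]; exists k; rewrite -(lin0 fl) -Hk.
elim: k {Hk} => //= k ->.
by rewrite [in RHS](linD fl) (linN fl) (linZ fl) fT.
Qed.

Lemma graded_map (M H : lmodType C) (act : W -> int -> M -> M)
    (act' : W -> int -> H -> H) (f : M -> H) x :
  linear f -> (forall w n x, f (act w n x) = act' w n (f x)) ->
  graded act ->
  exists s : seq (C * H),
    (forall p, p \in s -> gen_eigen (act' (conf W) 1) p.1 p.2) /\
    f x = \sum_(p <- s) p.2.
Proof.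
move=> fl fa gr; have [s [sP ->]] := gr x.
exists [seq (p.1, f p.2) | p <- s]; split.
  by move=> _ /mapP[p ps ->] /=; apply: gen_eigen_map (sP _ ps).
by rewrite big_map (linear_sum _ _ fl).
Qed.

Definition bor_l (V M : lmodType C) (Y : V -> int -> V -> V)
    (act : V -> int -> M -> M) u v (l m n : int) x (i : nat) : M :=
  gbinom m%:~R i *: act (Y u (l + i%:Z) v) (m + n - i%:Z) x.

Definition bor_r (V M : lmodType C)
    (act : V -> int -> M -> M) u v (l m n : int) x (i : nat) : M :=
  ((-1) ^+ i * gbinom l%:~R i) *:
       (act u (m + l - i%:Z) (act v (n + i%:Z) x)
        - (-1) ^ l *: act v (n + l - i%:Z) (act u (m + i%:Z) x)).

Lemma trunc_nat (P : int -> Prop) (l : int) :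
  (exists N : int, forall n, N <= n -> P n) ->
  exists N : nat, forall i, (N <= i)%N -> P (l + i%:Z).
Proof.
move=> [N HN]; exists `|N - l|%N => i Hi; apply: HN.
rewrite -lerBlDl; apply: le_trans (ler_norm _) _.
by rewrite -abszE lez_nat.
Qed.

Section Weak.
Variables (M : lmodType C) (act : W -> int -> M -> M).
Hypothesis linl : forall n x, linear (fun u => act u n x).
Hypothesis linr : forall u n, linear (act u n).

Lemma bor_l0 u v l m n x :
  eventually0 (bor_l (@vmode W) act u v l m n x).
Proof.
have [N HN] := trunc_nat l (vmode_trunc u v).
exists N => i /HN; rewrite /bor_l => ->.
by rewrite (lin0 (linl _ _)) scaler0.
Qed.

Lemma bor_r0 u v l m n x :
  (exists N : int, forall n, N <= n -> act v n x = 0) ->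
  (exists N : int, forall n, N <= n -> act u n x = 0) ->
  eventually0 (bor_r act u v l m n x).
Proof.
move=> /(trunc_nat n)[N HN] /(trunc_nat m)[N' HN'].
exists (maxn N N') => i; rewrite geq_max => /andP[/HN Hi /HN' Hi'].
by rewrite /bor_r Hi Hi' !(lin0 (linr _ _)) scaler0 subr0 scaler0.
Qed.

Lemma bor_l_lin u v l m n i : linear (fun x => bor_l (@vmode W) act u v l m n x i).
Proof.
by move=> a x y; rewrite /bor_l linr scalerDr !scalerA (mulrC a).
Qed.

Lemma bor_r_lin u v l m n i : linear (fun x => bor_r act u v l m n x i).
Proof.
move=> a x y; rewrite /bor_r !linr [(-1) ^ l *: _]scalerDr.
rewrite [(-1) ^ l *: (a *: _)]scalerA (mulrC _ a) -[(a * _) *: _]scalerA opprD addrACA.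
by rewrite -scalerBr scalerDr !scalerA (mulrC a).
Qed.

Definition weak_at x :=
  [/\ forall u, exists N : int, forall n, N <= n -> act u n x = 0,
      forall n, act (vacuum W) n x = (if n == -1 then x else 0) &
      forall u v l m n,
        \sum_(i \in [set: nat]) bor_l (@vmode W) act u v l m n x i =
        \sum_(i \in [set: nat]) bor_r act u v l m n x i].

Lemma weak_at0 : weak_at 0.
Proof.
have bl u v l m n : \sum_(i \in [set: nat]) bor_l (@vmode W) act u v l m n 0 i = 0.
  by apply: fsbig1 => i _; exact: (lin0 (bor_l_lin u v l m n i)).
have br u v l m n : \sum_(i \in [set: nat]) bor_r act u v l m n 0 i = 0.
  by apply: fsbig1 => i _; exact: (lin0 (bor_r_lin u v l m n i)).
split=> [u|n|u v l m n]; last by rewrite bl br.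
  by exists 0 => n _; rewrite (lin0 (linr _ _)).
by rewrite (lin0 (linr _ _)) if_same.
Qed.

Lemma weak_atD x y : weak_at x -> weak_at y -> weak_at (x + y).
Proof.
move=> [tx vx bx] [ty vy b_y]; split=> [u|n|u v l m n].
- have [N HN] := tx u; have [N' HN'] := ty u.
  exists (Num.max N N') => n; rewrite ge_max => /andP[/HN Hn /HN' Hn'].
  by rewrite (linD (linr _ _)) Hn Hn' addr0.
- by rewrite (linD (linr _ _)) vx vy; case: ifP; rewrite ?addr0.
under eq_fsbigr do rewrite (linD (bor_l_lin _ _ _ _ _ _)).
under [RHS]eq_fsbigr do rewrite (linD (bor_r_lin _ _ _ _ _ _)).
rewrite !fsumD ?bx ?b_y //; by [exact: bor_l0 | exact: bor_r0].
Qed.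

Lemma weak_atP : (forall x, weak_at x) -> weak_module act.
Proof.
move=> wP; split=> //.
- by move=> u x; have [] := wP x.
- by move=> n x; have [] := wP x.
- by move=> u v l m n x; have [_ _] := wP x; apply.
Qed.

Lemma weak_at_map (M' : lmodType C) (act' : W -> int -> M' -> M')
    (f : M' -> M) x :
  linear f -> (forall w n x, f (act' w n x) = act w n (f x)) ->
  weak_module act' -> weak_at (f x).
Proof.
move=> fl fa wk; split=> [u|n|u v l m n].
- by have [N HN] := act_trunc wk u x; exists N => n /HN; rewrite -fa => ->;
    exact: lin0.
- by rewrite -fa (act_vacuum wk); case: ifP => // _; exact: lin0.
have fbl i : bor_l (@vmode W) act u v l m n (f x) i =
             f (bor_l (@vmode W) act' u v l m n x i).
  by rewrite /bor_l (linZ fl) fa.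
have fbr i : bor_r act u v l m n (f x) i = f (bor_r act' u v l m n x i).
  by rewrite /bor_r (linZ fl) (linD fl) (linN fl) (linZ fl) !fa.
under eq_fsbigr do rewrite fbl.
under [RHS]eq_fsbigr do rewrite fbr.
rewrite -!(fsum_lin fl); first by congr f; exact: act_borcherds wk u v l m n x.
  have [N HN] := trunc_nat n (act_trunc wk v x).
  have [N' HN'] := trunc_nat m (act_trunc wk u x).
  exists (maxn N N') => i; rewrite geq_max => /andP[/HN Hi /HN' Hi'].
  rewrite /bor_r Hi Hi' !(lin0 (act_linr wk _ _)).
  by rewrite scaler0 subr0 scaler0.
have [N HN] := trunc_nat l (vmode_trunc u v).
exists N => i /HN; rewrite /bor_l => ->.
by rewrite (lin0 (act_linl wk _ _)) scaler0.
Qed.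

End Weak.
End Transport.

Section QuotientBimod.
Variables (H : bimod) (K : H -> Prop) (HK : subrep K).
Let KS := subrep_submod HK.

Section OneAction.
Variable act : W -> int -> H -> H.
Hypothesis wk : weak_module act.
Hypothesis Kact : forall w n x, K x -> K (act w n x).
Hypothesis gr : graded act.

Definition quot_act w n (q : quot KS) : quot KS := qpi KS (act w n (qrepr q)).

Lemma quot_actE w n x : qpi KS (act w n x) = quot_act w n (qpi KS x).
Proof.
apply/qpiP; rewrite -(linN (act_linr wk w n)) -(linD (act_linr wk w n)).
by apply: Kact; rewrite -opprB; have := subKZ KS (-1) (qpiK KS x);
   rewrite scaleN1r.
Qed.

Lemma quot_weak : weak_module quot_act.
Proof.
have ll n q : linear (fun u => quot_act u n q).
  by move=> a u v; rewrite /quot_act (act_linl wk) qpi_linear.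
have lr u n : linear (quot_act u n).
  move=> a p q; rewrite -(qreprK p) -(qreprK q) -qpi_linear -!quot_actE.
  by rewrite (act_linr wk) qpi_linear.
apply: weak_atP => // q; rewrite -(qreprK q).
by apply: (weak_at_map _ (@qpi_linear _ _ _ KS) quot_actE wk).
Qed.

Lemma quot_graded : graded quot_act.
Proof.
move=> q; rewrite -(qreprK q).
exact: graded_map (@qpi_linear _ _ _ KS) quot_actE gr.
Qed.

End OneAction.

Lemma quot_actC u m v n q :
  quot_act (@actl H) u m (quot_act (@actr H) v n q) =
  quot_act (@actr H) v n (quot_act (@actl H) u m q).
Proof.
have El := quot_actE (actl_weak H) (subrep_l HK).
have Er := quot_actE (actr_weak H) (subrep_r HK).
by rewrite -(qreprK q) -Er -!El -Er actlrC.
Qed.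

Definition quot_bimod : bimod :=
  Bimod (quot_weak (actl_weak H) (subrep_l HK))
        (quot_weak (actr_weak H) (subrep_r HK)) quot_actC
        (quot_graded (actl_weak H) (subrep_l HK) (actl_graded (b := H)))
        (quot_graded (actr_weak H) (subrep_r HK) (actr_graded (b := H))).

End QuotientBimod.

Section SumTensorBimod.
Variables (I : choiceType) (M N : I -> wmod).

Local Notation ST := (sum_tensor (fun k => wspace (M k)) (fun k => wspace (N k))).
Local Notation tn := (@tens R I (fun k => wspace (M k)) (fun k => wspace (N k)) _).

Definition st_actl (w : W) (n : int) : ST -> ST :=
  sum_tensor_lift (fun k (x : M k) (y : N k) => tn (wact w n x) y).

Definition st_actr (w : W) (n : int) : ST -> ST :=
  sum_tensor_lift (fun k (x : M k) (y : N k) => tn x (wact w n y)).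

Lemma st_bilin_l1 w n k (y : N k) : linear (fun x : M k => tn (wact w n x) y).
Proof. by move=> a x x'; rewrite (act_linr (wact_weak (M k))) tens_linl. Qed.
Lemma st_bilin_l2 w n k (x : M k) : linear (fun y : N k => tn (wact w n x) y).
Proof. by move=> a y y'; rewrite tens_linr. Qed.
Lemma st_bilin_r1 w n k (y : N k) : linear (fun x : M k => tn x (wact w n y)).
Proof. by move=> a x x'; rewrite tens_linl. Qed.
Lemma st_bilin_r2 w n k (x : M k) : linear (fun y : N k => tn x (wact w n y)).
Proof. by move=> a y y'; rewrite (act_linr (wact_weak (N k))) tens_linr. Qed.

Lemma st_actlE w n k (x : M k) (y : N k) :
  st_actl w n (tn x y) = tn (wact w n x) y.
Proof. exact: (sum_tensor_liftE (st_bilin_l1 w n) (st_bilin_l2 w n)). Qed.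
Lemma st_actrE w n k (x : M k) (y : N k) :
  st_actr w n (tn x y) = tn x (wact w n y).
Proof. exact: (sum_tensor_liftE (st_bilin_r1 w n) (st_bilin_r2 w n)). Qed.

Lemma st_actl_lin w n : linear (st_actl w n).
Proof. exact: (sum_tensor_lift_linear (st_bilin_l1 w n) (st_bilin_l2 w n)). Qed.
Lemma st_actr_lin w n : linear (st_actr w n).
Proof. exact: (sum_tensor_lift_linear (st_bilin_r1 w n) (st_bilin_r2 w n)). Qed.

Lemma st_actl_linl n x : linear (fun u => st_actl u n x).
Proof.
move=> a u v; elim/sum_tensor_ind: x => [|x y Hx Hy|k x y].
- by rewrite !(lin0 (st_actl_lin _ _)) scaler0 addr0.
- by rewrite !(linD (st_actl_lin _ _)) Hx Hy scalerDr addrACA.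
by rewrite !st_actlE (act_linl (wact_weak (M k))) tens_linl.
Qed.
Lemma st_actr_linl n x : linear (fun u => st_actr u n x).
Proof.
move=> a u v; elim/sum_tensor_ind: x => [|x y Hx Hy|k x y].
- by rewrite !(lin0 (st_actr_lin _ _)) scaler0 addr0.
- by rewrite !(linD (st_actr_lin _ _)) Hx Hy scalerDr addrACA.
by rewrite !st_actrE (act_linl (wact_weak (N k))) tens_linr.
Qed.

Lemma st_weak_l : weak_module st_actl.
Proof.
apply: weak_atP; [exact: st_actl_linl|exact: st_actl_lin|].
elim/sum_tensor_ind => [|x y|k x y].
- exact: weak_at0 st_actl_lin.
- exact: weak_atD st_actl_linl st_actl_lin _ _.
apply: (weak_at_map x (tens_linl y)) (wact_weak (M k)) => w n x'.
by rewrite st_actlE.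
Qed.
Lemma st_weak_r : weak_module st_actr.
Proof.
apply: weak_atP; [exact: st_actr_linl|exact: st_actr_lin|].
elim/sum_tensor_ind => [|x y|k x y].
- exact: weak_at0 st_actr_lin.
- exact: weak_atD st_actr_linl st_actr_lin _ _.
apply: (weak_at_map y (tens_linr x)) (wact_weak (N k)) => w n x'.
by rewrite st_actrE.
Qed.

Lemma graded_ind (act : W -> int -> ST -> ST) :
  (forall k (x : M k) (y : N k), exists s : seq (C * ST),
    (forall p, p \in s -> gen_eigen (act (conf W) 1) p.1 p.2) /\
    tn x y = \sum_(p <- s) p.2) -> graded act.
Proof.
move=> gt; elim/sum_tensor_ind => [|x y [s [sP ->]] [t [tP ->]]|//].
  by exists [::]; rewrite big_nil.
exists (s ++ t); rewrite big_cat; split=> // p.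
by rewrite mem_cat => /orP[/sP|/tP].
Qed.

Lemma st_graded_l : graded st_actl.
Proof.
apply: graded_ind => k x y.
apply: (graded_map x (tens_linl y)) (wgraded (w := M k)) => w n x'.
by rewrite st_actlE.
Qed.
Lemma st_graded_r : graded st_actr.
Proof.
apply: graded_ind => k x y.
apply: (graded_map y (tens_linr x)) (wgraded (w := N k)) => w n x'.
by rewrite st_actrE.
Qed.

Lemma st_actC u m v n x :
  st_actl u m (st_actr v n x) = st_actr v n (st_actl u m x).
Proof.
elim/sum_tensor_ind: x => [|x y Hx Hy|k x y].
- by rewrite !(lin0 (st_actr_lin _ _), lin0 (st_actl_lin _ _)).
- by rewrite !(linD (st_actr_lin _ _), linD (st_actl_lin _ _)) Hx Hy.
by rewrite st_actrE !st_actlE st_actrE.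
Qed.

(* The direct sum of the M k \otimes_C \bar (N k). *)
Definition st_bimod : bimod :=
  Bimod st_weak_l st_weak_r st_actC st_graded_l st_graded_r.

Definition st_tens (k : I) (x : M k) (y : N k) : st_bimod := tn x y.

End SumTensorBimod.

(* Families c : C -> U with c b of weight b are the elements of the algebraic
   completion of U. *)

(* V(u, z) v in the completion, where log z = l and z^s = e^(s l). *)
Definition iop_at (l : C) (A B U : wmod) (V : intop A B U) (u : A) (v : B)
    (b : C) : U :=
  \sum_(n \in [set: C]) \sum_(k \in [set: nat])
     (cexp (- (n + 1) * l) * l ^+ k) *: wcomp b (V u n k v).

(* e^(z L_(-1)) on the completion. *)
Definition translation (z : C) (U : wmod) (c : C -> U) (b : C) : U :=
  \sum_(j \in [set: nat])
     (z ^+ j / (j`!)%:R) *: iter j (wact (conf W) 0) (c (b - j%:R)).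

(* e^(- i y L_(-1)) V(u, 2 i y) v, where log (2 i y) = l. *)
Definition bulk_op (y : R) (l : C) (A B U : wmod) (V : intop A B U)
    (u : A) (v : B) : C -> U :=
  translation (- (0 +i* y)) (iop_at l V u v).

Section Bulk.
Variables (Rep : wmod -> Prop) (RW : Rep adj) (cj : conjugation Rep).
Variables (y : R) (l : C).

Local Notation Wd := (dualW RW cj).

(* H = K^ / Q is expressed by a surjective intertwiner from
   K^ = \bigoplus_k M k \otimes \bar (N k) onto H, with kernel Q.  Compatibility
   asks for some such presentation; beta has its values in the completion. *)
Definition compatible (H : bimod) (beta : H -> C -> Wd) : Prop :=
  [/\ forall b, linear (fun x => beta x b),
      forall x b, weight_space b (beta x b) &
      exists (I : choiceType) (M N : I -> robj Rep)
             (q : bihom (st_bimod M N) H),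
        bisurjective q /\
        forall k, exists V : intop (M k) (N k) Wd,
          forall (u : M k) (v : N k),
            beta (q (st_tens (M := M) (N := N) u v)) = bulk_op y l V u v].

Record bulk_pair := BulkPair {
  bp_space : bimod;
  bp_map : bp_space -> C -> Wd;
  bp_compatible : compatible bp_map }.

Definition bulk_arrow (X Y : bulk_pair) (f : bihom (bp_space X) (bp_space Y)) :
  Prop := forall x, bp_map (f x) = bp_map x.

Definition terminal (T : bulk_pair) : Prop :=
  forall X : bulk_pair,
    (exists g : bihom (bp_space X) (bp_space T), bulk_arrow g) /\
    (forall g g' : bihom (bp_space X) (bp_space T),
       bulk_arrow g -> bulk_arrow g' -> g =1 g').

Section ProjectiveCovers.
Variables (A : finType) (P : A -> robj Rep).

(* Every quotient of a direct sum of M k \otimes \bar (N k), with M k and N k in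
   Rep(W), is a quotient of \bigoplus_(a, b) m_ab P(a) \otimes \bar P(b); the
   multiplicity m_ab is given as an index set m a b. *)
Definition standing_assumption : Prop :=
  forall (H : bimod) (I : choiceType) (M N : I -> robj Rep)
         (q : bihom (st_bimod M N) H), bisurjective q ->
  exists (m : A -> A -> choiceType)
         (q' : bihom (st_bimod
                  (fun k : {ab : A * A & m ab.1 ab.2} => P (tag k).1)
                  (fun k : {ab : A * A & m ab.1 ab.2} => P (tag k).2)) H),
    bisurjective q'.

Definition Hhat : bimod := st_bimod P (fun a => cobj cj (P a)).

Variables (fu : fusion Rep) (pr : canonical_pairing RW cj fu).

(* The components beta x b are extended bilinearly from pure tensors. *)
Definition betahat (x : Hhat) (b : C) : Wd :=
  sum_tensor_lift
    (fun a (u : P a) (v : cobj cj (P a)) =>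
       bulk_op y l (fop (ev pr (P a))) u v b) x.

Definition ker_betahat (x : Hhat) : Prop := forall b, betahat x b = 0.

Definition Hbulk (HK : subrep ker_betahat) : bimod := quot_bimod HK.

Definition beta_bb (HK : subrep ker_betahat) : Hbulk HK -> C -> Wd :=
  quot_map betahat.

End ProjectiveCovers.
End Bulk.

End Modules.
End VOA.

(* Main.v *)
Require Import Defs.
From HB Require Import structures.
From mathcomp Require Import all_boot all_order all_algebra.
From mathcomp Require Import complex.
From mathcomp Require Import boolp classical_sets reals.
From mathcomp Require Import functions cardinality fsbigop exp trigo.
From mathcomp Require Import zify ring.

(* With z = 2iy, the correlator of u \otimes v is V(u, z) v up to an invertible
   translation.  The contour integrals of t^q (t - z)^p w(t) give Ward identities
   for it, and by downward induction on the modes they show that the value of a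
   correlator at a vector determines its values at all descendants of that
   vector.  Hence the kernel of betahat is a subrepresentation, and any map g
   with beta_bb g = beta' is automatically an intertwiner; it is unique because
   beta_bb is injective.  It exists as soon as every value of beta' is a value of
   betahat.  This holds because a pairing M \otimes_f N -> W^*, composed with some
   f : P(a) -> M, factors through ev_P(a), and the images of such f span M by the
   standing assumption. *)

Set Implicit Arguments.
Unset Strict Implicit.
Unset Printing Implicit Defensive.

Import Order.TTheory GRing.Theory Num.Theory.
Local Open Scope complex_scope.
Local Open Scope ring_scope.

(** * Linear independence of generalized eigenspaces *)

Section GeneralizedEigenspaces.
Variables (R : realType) (V : lmodType R[i]) (T : V -> V) (Tl : linear T).

Lemma iter_linear (f : V -> V) k : linear f -> linear (iter k f).
Proof. by move=> fl; elim: k => [|k IH] a x y //=; rewrite IH fl. Qed.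

Lemma shift_linear (c : R[i]) : linear (fun x => T x - c *: x).
Proof.
move=> a x y; rewrite Tl scalerDr opprD addrACA scalerBr.
by rewrite !scalerA (mulrC c).
Qed.

Lemma iter_shift0 (c : R[i]) k j x :
  iter k (fun x => T x - c *: x) x = 0 ->
  iter (j + k) (fun x => T x - c *: x) x = 0.
Proof. by move=> h; rewrite iterD h (lin0 (iter_linear j (shift_linear c))). Qed.

Lemma gen_eigen_submod a : submodule (gen_eigen T a).
Proof.
split=> [|c x y [k hx] [j hy]]; first by exists 0%N.
exists (k + j)%N; rewrite (iter_linear _ (shift_linear a)).
by rewrite (iter_shift0 k hy) addnC (iter_shift0 j hx) scaler0 addr0.
Qed.

Lemma gen_eigen_shift a c y : gen_eigen T a y -> gen_eigen T a (T y - c *: y).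
Proof.
apply: (gen_eigen_map (f := fun y => T y - c *: y)) (shift_linear c) _ => x.
by rewrite (linD Tl) (linN Tl) (linZ Tl).
Qed.

(** By induction on k the vector y is an honest c-eigenvector; then (T - a)^j multiplies it by (c -
    a)^j, and some such power kills it. *)
Lemma gen_eigen_inj a c k y : a != c -> gen_eigen T a y ->
  iter k (fun x => T x - c *: x) y = 0 -> y = 0.
Proof.
move=> ac; elim: k y => [//|k IH] y ya; rewrite iterSr => h.
have {IH h} Ty : T y = c *: y.
  by apply/eqP; rewrite -subr_eq0 (IH _ (gen_eigen_shift c ya) h).
have [j] := ya.
have -> : iter j (fun x => T x - a *: x) y = (c - a) ^+ j *: y.
  elim: j => [|j /= ->]; first by rewrite scale1r.
  by rewrite (linZ Tl) Ty !scalerA -scalerBl exprS mulrBl (mulrC c).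
move/eqP; rewrite scaler_eq0 expf_eq0 subr_eq0 eq_sym (negbTE ac) andbF.
by move/eqP.
Qed.

(** A power of T - p.1 kills the first term of the sum, commutes with T and is injective on the
    a-eigenspace, so it shortens the sum without losing y. *)
Lemma gen_eigen_indep a y (s : seq (R[i] * V)) : gen_eigen T a y ->
  (forall p, p \in s -> gen_eigen T p.1 p.2 /\ p.1 != a) ->
  y = \sum_(p <- s) p.2 -> y = 0.
Proof.
move=> ya; have [n] := ubnP (size s); elim: n s y ya => // n IH [|p s] y ya.
  by move=> _ _; rewrite big_nil.
rewrite ltnS => /= sn sP yE.
have [[k pk] pa] := sP p (mem_head _ _).
pose f := iter k (fun x => T x - p.1 *: x).
have fl : linear f by exact: iter_linear (shift_linear _).
have fT x : f (T x) = T (f x).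
  rewrite /f; elim: k {pk f fl} x => //= k IHk x.
  by rewrite IHk (linD Tl) (linN Tl) (linZ Tl).
apply: (@gen_eigen_inj a p.1 k); rewrite 1?eq_sym //.
apply: (IH [seq (q.1, f q.2) | q <- s] (f y)).
- exact: gen_eigen_map fl fT ya.
- by rewrite size_map.
- move=> _ /mapP[q qs ->] /=; have [] := sP q; first by rewrite inE qs orbT.
  by move=> qe qa; split=> //; apply: gen_eigen_map fl fT qe.
by rewrite big_map yE big_cons (linD fl) {1}/f pk add0r (Defs.linear_sum _ _ fl).
Qed.

End GeneralizedEigenspaces.

(** * Weight components of a vector *)

Section WeightComponents.
Variables (R : realType) (W : voa R).

Lemma L0_linear (M : wmod W) : linear (fun x : M => wact (conf W) 1 x).
Proof. exact: (act_linr (wact_weak M)). Qed.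

Lemma weight_submod (M : wmod W) a : submodule (@weight_space R W M a).
Proof. exact: gen_eigen_submod (@L0_linear M) a. Qed.

Lemma gen_eigen_sum (M : wmod W) a (I : eqType) (s : seq I) (P : pred I)
    (F : I -> M) : (forall i, i \in s -> P i -> weight_space a (F i)) ->
  weight_space a (\sum_(i <- s | P i) F i).
Proof.
move=> h; rewrite big_seq_cond; apply: big_ind.
- exact: submod0 (weight_submod M a).
- by move=> x y; exact: (subKD (weight_submod M a)).
- by move=> i /andP[]; exact: h.
Qed.

(** [wcomp] is defined through a chosen decomposition; this frees it from the choice. *)
Lemma wcompE (M : wmod W) a (x : M) (s : seq (R[i] * M)) :
  (forall p, p \in s -> weight_space p.1 p.2) -> x = \sum_(p <- s) p.2 ->
  wcomp a x = \sum_(p <- s | p.1 == a) p.2.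
Proof.
move=> sP xE; rewrite /wcomp; case: cid => t [tP tE] /=.
have split_sum (r : seq (R[i] * M)) :
    \sum_(p <- r) p.2 =
    \sum_(p <- r | p.1 == a) p.2 + \sum_(p <- r | p.1 != a) p.2.
  by rewrite (bigID (fun p => p.1 == a)).
have comp_weight (r : seq (R[i] * M)) :
    (forall p, p \in r -> weight_space p.1 p.2) ->
    weight_space a (\sum_(p <- r | p.1 == a) p.2).
  by move=> rP; apply: gen_eigen_sum => p /rP + /eqP <-.
apply/eqP; rewrite -subr_eq0; apply/eqP.
(* The two candidates differ by a vector of weight a which is also the sum of [r], whose entries
   have other weights; by independence it is 0. *)
pose r := [seq (p.1, - p.2) | p <- t & p.1 != a] ++ [seq p <- s | p.1 != a].
apply: (@gen_eigen_indep R M _ (@L0_linear M) a _ r).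
- by apply: (subK (weight_submod M a)); apply: comp_weight.
- move=> p; rewrite mem_cat => /orP[/mapP[q]|]; rewrite mem_filter.
    move=> /andP[qa qt] -> /=; split=> //; rewrite -scaleN1r.
    exact: (subKZ (weight_submod M q.1)) (tP _ qt).
  by move=> /andP[pa /sP].
rewrite big_cat big_map !big_filter /= sumrN.
have := tE; rewrite [in LHS]xE !split_sum => h.
rewrite -(addrK (\sum_(p <- t | p.1 != a) p.2) (\sum_(p <- t | p.1 == a) p.2)).
by rewrite -h addrAC (addrC (\sum_(p <- s | p.1 == a) p.2)) addrK addrC.
Qed.

Lemma wcomp_id (M : wmod W) a (x : M) : weight_space a x -> wcomp a x = x.
Proof.
move=> xa; rewrite (@wcompE _ a x [:: (a, x)]) ?big_cons ?big_nil /= ?eqxx ?addr0 //.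
by move=> p; rewrite inE => /eqP ->.
Qed.

Lemma wcomp_neq (M : wmod W) a b (x : M) :
  weight_space a x -> a != b -> wcomp b x = 0.
Proof.
move=> xa ab; rewrite (@wcompE _ b x [:: (a, x)]) ?big_cons ?big_nil /= ?(negbTE ab) ?addr0 //.
by move=> p; rewrite inE => /eqP ->.
Qed.

Lemma wcomp_weight (M : wmod W) a (x : M) : weight_space a (wcomp a x).
Proof.
have [s [sP xE]] := wgraded x; rewrite (wcompE a sP xE).
by apply: gen_eigen_sum => p /sP + /eqP <-.
Qed.

Lemma wcomp_linear (M : wmod W) a : linear (@wcomp R W M a).
Proof.
move=> c x y; have [s [sP xE]] := wgraded x; have [t [tP yE]] := wgraded y.
rewrite (wcompE a sP xE) (wcompE a tP yE).
rewrite (@wcompE _ a _ ([seq (p.1, c *: p.2) | p <- s] ++ t)).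
- by rewrite big_cat big_map /= scaler_sumr.
- move=> p; rewrite mem_cat => /orP[/mapP[q qs ->]|/tP //] /=.
  exact: (subKZ (weight_submod M q.1)) (sP _ qs).
by rewrite big_cat big_map /= -scaler_sumr -xE -yE.
Qed.

Lemma weight_ind (M : wmod W) (Q : M -> Prop) :
  Q 0 -> (forall x y, Q x -> Q y -> Q (x + y)) ->
  (forall a x, weight_space a x -> Q x) -> forall x, Q x.
Proof.
move=> Q0 QD Qw x; have [s [sP ->]] := wgraded x.
by rewrite big_seq; apply: big_ind => // p /sP; exact: Qw.
Qed.

(** * Binomial coefficients and sums with one nonzero term *)

Lemma gbinom0 (x : R[i]) : gbinom x 0 = 1.
Proof. by rewrite /gbinom big_ord0 fact0 divr1. Qed.

Lemma gbinom0n i : gbinom (0 : R[i]) i = (i == 0%N)%:R.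
Proof.
case: i => [|i]; first by rewrite gbinom0.
by rewrite /gbinom big_ord_recl /= subr0 !mul0r.
Qed.

Lemma gbinom1n i : gbinom (1 : R[i]) i = (i < 2)%N%:R.
Proof.
case: i => [|[|i]]; first by rewrite gbinom0.
  by rewrite /gbinom big_ord_recl big_ord0 /= mulr0n subr0 mulr1 divr1.
by rewrite /gbinom !big_ord_recl /= subrr mul0r mulr0 mul0r.
Qed.

Lemma gbinomN2 i : gbinom (- 2 : R[i]) i = (-1) ^+ i * i.+1%:R.
Proof.
rewrite /gbinom; apply: (canLR (mulfK _)).
  by rewrite pnatr_eq0 -lt0n fact_gt0.
elim: i => [|i IH]; first by rewrite big_ord0 fact0 !mulr1.
rewrite big_ord_recr /= IH factS natrM exprS.
by rewrite -[i.+2%:R]natr1 -[i.+1%:R]natr1; ring.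
Qed.

Lemma fsum_nat1 (V : lmodType R[i]) (F : nat -> V) k :
  (forall i, i != k -> F i = 0) -> \sum_(i \in [set: nat]) F i = F k.
Proof.
move=> F0; rewrite (@fsum_nat _ _ _ k.+1); last first.
  by move=> i ki; apply: F0; rewrite gtn_eqF.
rewrite big_ord_recr /= big1 ?add0r // => i _; apply: F0.
by rewrite ltn_eqF.
Qed.

(** * Modes of the conformal vector and weights *)

Lemma conf0_vacuum (w : W) : vmode (conf W) 0 w = vmode w (- 2) (vacuum W).
Proof.
rewrite -[LHS]creation vmode_deriv; by rewrite opprK scale1r.
Qed.

(** This is the relation [L_0, L_(-2)] = 2 L_(-2) on the vacuum, which L_0 kills. *)
Lemma conf_weight : vmode (conf W) 1 (conf W) = 2 *: conf W.
Proof.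
have := virasoro 0 (- 2) (vacuum W).
rewrite !add0r (_ : - 2 + 1 = -1 :> int) // creation (creation_reg (conf W)) //.
by rewrite (lin0 (@vmode_linr _ W _ _)) subr0 ?(sub0r, opprK) /= scale0r addr0.
Qed.

(** The derivative rule is an axiom for W only. In a module it follows from L_(-1) w = w_(-2) vacuum
    and the Borcherds identity for w and the vacuum with l = -2 and m = 0. *)
Lemma act_deriv (M : lmodType R[i]) (act : W -> int -> M -> M) (w : W) n x :
  weak_module act ->
  act (vmode (conf W) 0 w) n x = - n%:~R *: act w (n - 1) x.
Proof.
move=> wk; rewrite conf0_vacuum.
have := act_borcherds wk w (vacuum W) (- 2) 0 n x.
rewrite (@fsum_nat1 _ _ 0%N); last first.
  by move=> i i0; rewrite gbinom0n (negbTE i0) scale0r.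
rewrite gbinom0 scale1r addr0 (_ : 0 + n - 0%:Z = n); last by lia.
move=> ->.
have GE i : (-1) ^+ i * gbinom ((- 2)%:~R : R[i]) i = i.+1%:R.
  rewrite mulrNz gbinomN2 mulrA -exprD -signr_odd oddD addbb.
  by rewrite expr0 mul1r.
have vac k z : act (vacuum W) k z = if k == -1 then z else 0 by apply: act_vacuum.
have aZ0 u k : act u k 0 = 0 by rewrite (lin0 (act_linr wk _ _)).
(* A vacuum mode survives only at index -1. For mode 0 this never happens; for a positive mode it
   picks one term of the second kind, for a negative mode one of the first kind. *)
case: n => [[|n]|n].
- rewrite oppr0 scale0r; apply: fsbig1 => i _.
  by rewrite !vac ifN ?ifN ?aZ0 ?scaler0 ?subr0 ?scaler0 //; lia.
- rewrite (@fsum_nat1 _ _ n); last first.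
    by move=> i ni; rewrite !vac ifN ?ifN ?aZ0 ?scaler0 ?subr0 ?scaler0 //; lia.
  rewrite GE !vac ifT; last by lia.
  rewrite (_ : (n.+1%:Z + n%:Z == -1) = false) ?aZ0; last by lia.
  rewrite sub0r -[(-1) ^ (-2)]/(((-1) ^+ 2)^-1) sqrrN expr1n invr1 scale1r.
  by rewrite scalerN scaleNr add0r; congr (- (_ *: act _ _ _)); lia.
rewrite (@fsum_nat1 _ _ n); last first.
  by move=> i ni; rewrite !vac ifN ?ifN ?aZ0 ?scaler0 ?subr0 ?scaler0 //; lia.
rewrite GE !vac (_ : (Negz n - 2 - n%:Z == -1) = false); last by lia.
rewrite (_ : (Negz n + n%:Z == -1) = true) ?scaler0 ?subr0; last by lia.
congr (_ *: act _ _ _); last by lia.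
by rewrite NegzE mulrNz opprK.
Qed.

(** The Borcherds identity with l = 0 and m = 1 is the commutator formula; its two terms are (L_0
    w)_n and (L_(-1) w)_(n+1), and [act_deriv] rewrites the latter. *)
Lemma act_commL0 (M : lmodType R[i]) (act : W -> int -> M -> M) (w : W) n x :
  weak_module act ->
  act (conf W) 1 (act w n x) - act w n (act (conf W) 1 x) =
  act (vmode (conf W) 1 w) n x - (n + 1)%:~R *: act w n x.
Proof.
move=> wk; have := act_borcherds wk (conf W) w 0 1 n x.
rewrite [in RHS](@fsum_nat1 _ _ 0%N); last first.
  by move=> i i0; rewrite gbinom0n (negbTE i0) mulr0 scale0r.
rewrite gbinom0 mulr1 expr0 !scale1r !(addr0, add0r, subr0) => <-.
rewrite (@fsum_nat _ _ _ 2); last first.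
  by move=> i i2; rewrite gbinom1n ltnNge i2 scale0r.
rewrite !big_ord_recl big_ord0 /= !gbinom1n /= !scale1r addr0 add0r.
rewrite (_ : 1 + n - 0%:Z = n + 1); last by lia.
rewrite (_ : bump 0 0 = 1%N) // (_ : 1 + n - 1%:Z = n) ?addr0; last by lia.
rewrite act_deriv // scaleNr addrC.
by congr (_ - _ *: act _ _ _); lia.
Qed.

Lemma act_weight (M : wmod W) (w : W) (h n : int) a (x : M) :
  vmode (conf W) 1 w = h%:~R *: w -> weight_space a x ->
  weight_space (a + (h - n - 1)%:~R) (wact w n x).
Proof.
move=> wh [k kx]; exists k.
have lr := act_linr (wact_weak M); have ll := act_linl (wact_weak M).
(* The mode w_n carries L_0 minus the old weight to L_0 minus the new one, so the nilpotency order k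
   is preserved. *)
pose D b (x : M) := wact (conf W) 1 x - b *: x.
have wD z : D (a + (h - n - 1)%:~R) (wact w n z) = wact w n (D a z).
  rewrite /D (linD (lr w n)) (linN (lr w n)) (linZ (lr w n)).
  rewrite -(subrK (wact w n (wact (conf W) 1 z)) (wact _ 1 (wact w n z))).
  rewrite act_commL0 ?(linZ (ll n z)) ?wh; last exact: wact_weak.
  rewrite (linZ (ll n z)) addrAC [RHS]addrC; congr (_ + _).
  rewrite -scalerBl -scalerBl -scaleNr.
  by congr (_ *: _); ring.
rewrite -(lin0 (lr w n)) -kx; elim: k {kx} => //= k ->.
by rewrite -/(D _ _) wD.
Qed.

Lemma adj_weight_ind (Q : W -> Prop) :
  Q 0 -> (forall x y, Q x -> Q y -> Q (x + y)) ->
  (forall (h : int) w, vmode (conf W) 1 w = h%:~R *: w -> Q w) -> forall w, Q w.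
Proof.
move=> Q0 QD Qw w; have [s [sP ->]] := vgraded w.
by rewrite big_seq; apply: big_ind => // p /sP; exact: Qw.
Qed.

End WeightComponents.

(** * The complex exponential, and a uniform bound over finitely many indices *)

Lemma cexpD (R : realType) (a b : R[i]) : cexp (a + b) = cexp a * cexp b.
Proof.
case: a b => [a1 a2] [b1 b2]; rewrite /cexp /= expRD cosD sinD rmorphM /=.
rewrite mulrACA; congr (_ * _); rewrite /GRing.mul /=.
by apply/eqP; rewrite eq_complex /= (addrC (sin a2 * _)) !eqxx.
Qed.

Lemma cexp_neq0 (R : realType) (a : R[i]) : cexp a != 0.
Proof.
have : cexp a * cexp (- a) = 1.
  by rewrite -cexpD subrr /cexp /= expR0 cos0 sin0 mul1r.
by move=> h; apply/eqP => a0; move/eqP: h; rewrite a0 mul0r eq_sym oner_eq0.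
Qed.

Lemma max_bound (N : nat) (Q : nat -> nat -> Prop) :
  (forall i, exists K, forall k, (K <= k)%N -> Q i k) ->
  exists K, forall i k, (i < N)%N -> (K <= k)%N -> Q i k.
Proof.
move=> h; elim: N => [|N [K IH]]; first by exists 0%N.
have [K' hK'] := h N; exists (maxn K K') => i k.
rewrite ltnS leq_eqVlt geq_max => /orP[/eqP ->|iN] /andP[Kk K'k].
  exact: hK'.
exact: IH.
Qed.

(** * Weights and convergence of logarithmic intertwining operators *)

Section IntertwiningOperators.
Variables (R : realType) (W : voa R) (A B U : wmod W) (V : intop A B U).

(** The Jacobi identity with l = 0 and m = 1, as for modules; the last term comes from
    differentiating (log x)^(k+1). *)
Lemma iop_commL0 u n k v :
  wact (conf W) 1 (V u n k v) =
  V (wact (conf W) 1 u) n k v + V u n k (wact (conf W) 1 v)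
  - (n + 1) *: V u n k v + k.+1%:R *: V u n k.+1 v.
Proof.
have := iop_jacobi V (conf W) u 0 1 n k v.
rewrite [in RHS](@fsum_nat1 _ _ _ 0%N); last first.
  by move=> i i0; rewrite gbinom0n (negbTE i0) mulr0 scale0r.
rewrite gbinom0 mulr1 expr0 !scale1r !(addr0, add0r, subr0).
rewrite (@fsum_nat _ _ _ 2); last first.
  by move=> i i2; rewrite gbinom1n ltnNge i2 scale0r.
rewrite !big_ord_recl big_ord0 /= !gbinom1n /= !scale1r addr0 !add0r.
rewrite (_ : bump 0 0 = 1%N) // subr0 iop_deriv.
rewrite (_ : 1%:~R + n - 1 = n); last by ring.
move=> /eqP; rewrite eq_sym subr_eq => /eqP ->.
by rewrite addr0 scaleNr (addrC 1%:~R) -addrA addrC addrA.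
Qed.

(** By [iop_commL0], L_0 - e sends V u n k v to terms with u or v of smaller nilpotency order or
    with a higher power of log x. Hence a triple induction. *)
Lemma iop_weight a c u v n k : weight_space a u -> weight_space c v ->
  weight_space (a + c - n - 1) (V u n k v).
Proof.
pose e := a + c - n - 1.
have step (x : U) : weight_space e (wact (conf W) 1 x - e *: x) ->
    weight_space e x.
  by move=> [j hj]; exists j.+1; rewrite iterSr.
have UE := weight_submod U e.
case=> p; elim: p u v k => [|p IHp] u v k.
  by move=> /= -> _; rewrite (lin0 (iop_linl V _ _ _)); exact: submod0 UE.
rewrite iterSr => hu [q]; elim: q v k => [|q IHq] v k.
  by move=> /= ->; rewrite (lin0 (iop_linr V _ _ _)); exact: submod0 UE.
rewrite iterSr => hv.
(* The innermost induction runs downward in k from the bound [K] on log powers. *)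
have [K hK] := iop_log V u v n.
have [r] := ubnP (K - k)%N; elim: r k => // r IHr k rk.
case: (leqP K k) => Kk; first by rewrite hK //; exact: submod0 UE.
apply: step; have := iop_commL0 u n k v.
set u' := (X in iter p _ X = 0) in hu; set v' := (X in iter q _ X = 0) in hv.
have -> : wact (conf W) 1 u = u' + a *: u by rewrite subrK.
have -> : wact (conf W) 1 v = v' + c *: v by rewrite subrK.
rewrite (linD (iop_linl V _ _ _)) (linZ (iop_linl V _ _ _)).
rewrite (linD (iop_linr V _ _ _)) (linZ (iop_linr V _ _ _)) => ->.
have -> : V u' n k v + a *: V u n k v + (V u n k v' + c *: V u n k v)
    - (n + 1) *: V u n k v + k.+1%:R *: V u n k.+1 v - e *: V u n k v =
    V u' n k v + V u n k v' + k.+1%:R *: V u n k.+1 v.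
  rewrite addrACA -scalerDl -[_ + _ - (n + 1) *: _]addrA -scalerBl addrAC.
  rewrite -[_ - e *: _]addrA -scalerBl (_ : _ - e = 0) ?scale0r ?addr0 //.
  by rewrite /e; ring.
apply: (subKD UE); last by apply/(subKZ UE)/IHr; lia.
apply: (subKD UE); last exact: IHq.
by apply: IHp => //; exists q.+1; rewrite iterSr.
Qed.

(** A finite window of exponents and log powers that carries the whole component of weight b; it
    turns the sums in [iop_at] into finite ones. *)
Definition iop_support (b : R[i]) u v (r : seq R[i]) (K : nat) : Prop :=
  forall n k, (n \notin r) || (K <= k)%N -> wcomp b (V u n k v) = 0.

Lemma iop_support_ex b u v : exists r K, iop_support b u v r K.
Proof.
have [r rP] : exists r : seq R[i], forall n k, n \notin r -> wcomp b (V u n k v) = 0.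
  have w0 := lin0 (@wcomp_linear R W U b); have wD := linD (@wcomp_linear R W U b).
  elim/weight_ind: u => [|u u' [r hr] [r' hr']|a u ua].
  - by exists [::] => n k _; rewrite (lin0 (iop_linl V _ _ _)).
  - exists (r ++ r') => n k; rewrite mem_cat negb_or => /andP[nr nr'].
    by rewrite (linD (iop_linl V _ _ _)) wD hr // hr' // addr0.
  elim/weight_ind: v => [|v v' [r hr] [r' hr']|c v vc].
  - by exists [::] => n k _; rewrite (lin0 (iop_linr V _ _ _)).
  - exists (r ++ r') => n k; rewrite mem_cat negb_or => /andP[nr nr'].
    by rewrite (linD (iop_linr V _ _ _)) wD hr // hr' // addr0.
  (* By [iop_weight] this is the only exponent that reaches weight b. *)
  exists [:: a + c - b - 1] => n k; rewrite inE => nE.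
  apply: (wcomp_neq (iop_weight n k ua vc)); apply: contraNneq nE => <-.
  by apply/eqP; ring.
have [K KP] : exists K, forall n k, n \in r -> (K <= k)%N -> V u n k v = 0.
  elim: r {rP} => [|n r [K hK]]; first by exists 0%N.
  have [K' hK'] := iop_log V u v n; exists (maxn K K') => m k.
  rewrite inE geq_max => /orP[/eqP ->|mr] /andP[Kk K'k]; first exact: hK'.
  exact: hK.
exists r, K => n k; case nr: (n \in r) => /= Kk; last by rewrite rP ?nr.
by rewrite (KP n k) // (lin0 (@wcomp_linear R W U b)).
Qed.

Lemma iop_atE l b u v r K : uniq r -> iop_support b u v r K ->
  iop_at l V u v b =
  \sum_(n <- r) \sum_(k < K) (cexp (- (n + 1) * l) * l ^+ k) *: wcomp b (V u n k v).
Proof.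
move=> ur rK; rewrite /iop_at (@fsbigE _ _ _ _ _ r) //; last first.
  by move=> n _ /= nr; apply: fsbig1 => k _; rewrite rK ?nr // scaler0.
rewrite (eq_bigl xpredT); last by move=> i; rewrite in_setT.
apply: eq_bigr => n _; apply: fsum_nat => k Kk.
by rewrite rK ?Kk ?orbT // scaler0.
Qed.

(** A common window lets linearity be checked term by term. *)
Lemma iop_support_cat b u v u' v' : exists r K,
  [/\ uniq r, iop_support b u v r K & iop_support b u' v' r K].
Proof.
have [r [K rK]] := iop_support_ex b u v.
have [r' [K' rK']] := iop_support_ex b u' v'.
exists (undup (r ++ r')), (maxn K K'); split; first exact: undup_uniq.
  move=> n k; rewrite mem_undup mem_cat geq_max => h; apply: rK.
  by case/orP: h => [|/andP[->]]; rewrite ?orbT // negb_or => /andP[->].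
move=> n k; rewrite mem_undup mem_cat geq_max => h; apply: rK'.
by case/orP: h => [|/andP[_ ->]]; rewrite ?orbT // negb_or => /andP[_ ->].
Qed.

Lemma iop_at_linl l b v : linear (fun u => iop_at l V u v b).
Proof.
move=> a u u'; have [r [K [ur s s']]] := iop_support_cat b u v u' v.
have wl := @wcomp_linear R W U b.
have sl : iop_support b (a *: u + u') v r K.
  by move=> n k h; rewrite iop_linl wl s // s' // scaler0 addr0.
rewrite (iop_atE _ ur s) (iop_atE _ ur s') (iop_atE _ ur sl).
rewrite scaler_sumr -big_split /=; apply: eq_bigr => n _.
rewrite scaler_sumr -big_split /=; apply: eq_bigr => k _.
by rewrite iop_linl wl scalerDr !scalerA (mulrC a).
Qed.

Lemma iop_at_linr l b u : linear (fun v => iop_at l V u v b).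
Proof.
move=> a v v'; have [r [K [ur s s']]] := iop_support_cat b u v u v'.
have wl := @wcomp_linear R W U b.
have sl : iop_support b u (a *: v + v') r K.
  by move=> n k h; rewrite iop_linr wl s // s' // scaler0 addr0.
rewrite (iop_atE _ ur s) (iop_atE _ ur s') (iop_atE _ ur sl).
rewrite scaler_sumr -big_split /=; apply: eq_bigr => n _.
rewrite scaler_sumr -big_split /=; apply: eq_bigr => k _.
by rewrite iop_linr wl scalerDr !scalerA (mulrC a).
Qed.

Lemma iop_at_weight l b u v : weight_space b (iop_at l V u v b).
Proof.
have [r [K [ur s _]]] := iop_support_cat b u v u v.
rewrite (iop_atE _ ur s); apply: gen_eigen_sum => n _ _.
apply: gen_eigen_sum => k _ _; apply: (subKZ (weight_submod U b)).
exact: wcomp_weight.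
Qed.

Lemma iop_at_homogeneous l a c b n u v K : weight_space a u -> weight_space c v ->
  n = a + c - b - 1 -> (forall k, (K <= k)%N -> V u n k v = 0) ->
  iop_at l V u v b = \sum_(k < K) (cexp (- (n + 1) * l) * l ^+ k) *: V u n k v.
Proof.
move=> ua vc nE nK; rewrite (@iop_atE _ _ _ _ [:: n] K) //.
  rewrite big_cons big_nil addr0; apply: eq_bigr => k _.
  congr (_ *: _); apply: wcomp_id; have := iop_weight n k ua vc.
  by congr (weight_space _ _); rewrite nE; ring.
move=> m k; rewrite inE => /orP[mn|/nK]; last first.
  case: (eqVneq m n) => [-> ->|mn _]; first exact: (lin0 (@wcomp_linear R W U b)).
  apply: (wcomp_neq (iop_weight m k ua vc)); apply: contraNneq mn => bE.
  by rewrite nE -bE; apply/eqP; ring.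
apply: (wcomp_neq (iop_weight m k ua vc)); apply: contraNneq mn => bE.
by rewrite nE -bE; apply/eqP; ring.
Qed.

End IntertwiningOperators.

(** * Ward identities for one intertwining operator *)

Section WardIdentities.
Variables (R : realType) (W : voa R) (l : R[i]).

(* The residue theorem for t^q (t - z)^p w(t), with z = e^l, applied to the
   vector V(u, z) v of components [c b]: on the left the residue at z, on the
   right those at infinity and at 0.  [cL n] and [cR n] stand for V(w_n u, z) v
   and V(u, z) w_n v, and w_(q+p-i) maps weight b - h + (q + p - i) + 1 to
   weight b.  In each component the sums over i are finite. *)
Definition ward (U : wmod W) (h : int) (w : W) (c : R[i] -> U)
    (cL cR : int -> R[i] -> U) : Prop :=
  forall (p q : int) b, exists N, forall N', (N <= N')%N ->
    \sum_(i < N') (gbinom q%:~R i * cexp ((q%:~R - i%:R) * l)) *: cL (p + i%:Z) b =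
    \sum_(i < N') ((-1) ^+ i * gbinom p%:~R i) *:
      (cexp (i%:R * l) *: wact w (q + p - i%:Z)
         (c (b - h%:~R + (q + p - i%:Z)%:~R + 1))
       - ((-1) ^ p * cexp ((p%:~R - i%:R) * l)) *: cR (q + i%:Z) b).

Lemma wardL (U : wmod W) h w (c c' : R[i] -> U) cL cL' cR cR' a :
  ward h w c cL cR -> ward h w c' cL' cR' ->
  ward h w (fun b => a *: c b + c' b) (fun n b => a *: cL n b + cL' n b)
    (fun n b => a *: cR n b + cR' n b).
Proof.
move=> H H' p q b; have [N HN] := H p q b; have [N' HN'] := H' p q b.
exists (maxn N N') => M; rewrite geq_max => /andP[/HN E /HN' E'].
under eq_bigr do rewrite scalerDr scalerA (mulrC _ a) -[(a * _) *: _]scalerA.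
rewrite big_split /= -scaler_sumr E E' scaler_sumr -big_split /=.
apply: eq_bigr => i _; rewrite (act_linr (wact_weak U)) !scalerDr !scalerN.
rewrite scalerDr opprD addrACA !scalerA.
by congr ((_ *: _ + _) + (- (_ *: _) - _)); ring.
Qed.

Lemma ward0 (U : wmod W) h w (c : R[i] -> U) cL cR :
  (forall b, c b = 0) -> (forall n b, cL n b = 0) -> (forall n b, cR n b = 0) ->
  ward h w c cL cR.
Proof.
move=> c0 L0 R0 p q b; exists 0%N => N' _.
rewrite !big1 // => i _; rewrite ?L0 ?c0 ?R0 ?scaler0 //.
by rewrite (lin0 (act_linr (wact_weak U) _ _)) !scaler0 subr0 scaler0.
Qed.

(** As k 0 is invertible, the relation at m expresses e m through later values, so vanishing spreads
    downward. *)
Lemma downward_zero (U : lmodType R[i]) (e : int -> U) (k : nat -> R[i]) :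
  (exists N : int, forall n, N <= n -> e n = 0) -> k 0%N != 0 ->
  (forall m, exists N, forall N', (N <= N')%N ->
     \sum_(i < N') k i *: e (m + i%:Z) = 0) ->
  forall n, e n = 0.
Proof.
move=> [M eM] k0 ek.
have : forall (d : nat) n, M - d%:Z <= n -> e n = 0.
  elim=> [|d IH] n dn; first by apply: eM; rewrite subr0 in dn.
  have [N /(_ N.+1 (leqnSn N))] := ek n.
  rewrite big_ord_recl /= big1 => [|i _]; last first.
    by rewrite IH ?scaler0 // /bump /=; lia.
  rewrite !addr0 => /eqP; rewrite scaler_eq0 (negbTE k0) => /eqP //.
by move=> h n; apply: (h `|M - n|%N); lia.
Qed.

Lemma ward_vanish (U : wmod W) h w (c : R[i] -> U) cL cR :
  ward h w c cL cR -> (forall b, c b = 0) ->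
  (exists N : int, forall n, N <= n -> forall b, cL n b = 0) ->
  (exists N : int, forall n, N <= n -> forall b, cR n b = 0) ->
  (forall n b, cL n b = 0) /\ (forall n b, cR n b = 0).
Proof.
move=> H c0 [NL HL] [NR HR].
have w0 n : wact w n (0 : U) = 0 by rewrite (lin0 (act_linr (wact_weak U) _ _)).
split=> n b.
(* With q = [NR] all terms in [cR] vanish, and the identities for varying p become a recursion for
   [cL]. *)
- apply: (@downward_zero _ (fun n => cL n b)
    (fun i => gbinom NR%:~R i * cexp ((NR%:~R - i%:R) * l))).
  + by exists NL => m /HL.
  + by rewrite gbinom0 mul1r cexp_neq0.
  move=> m; have [N HN] := H m NR b; exists N => N' /HN ->.
  rewrite big1 // => i _; rewrite c0 w0 HR ?scaler0 ?subr0 ?scaler0 //; lia.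
(* Symmetrically, p = [NL] removes [cL] and leaves a recursion in q for [cR]. *)
apply: (@downward_zero _ (fun n => cR n b) (fun i => (-1) ^+ i *
    gbinom NL%:~R i * - ((-1) ^ NL * cexp ((NL%:~R - i%:R) * l)))).
- by exists NR => m /HR.
- rewrite gbinom0 expr0 mulr1 mul1r oppr_eq0 mulf_neq0 ?cexp_neq0 //.
  by rewrite expfz_neq0 // oppr_eq0 oner_eq0.
move=> m; have [N HN] := H NL m b; exists N => N' /HN.
rewrite big1 => [|i _]; last by rewrite HL ?scaler0 //; lia.
move=> /esym E; rewrite -[RHS]E; apply: eq_bigr => i _.
by rewrite c0 w0 scaler0 sub0r -[LHS]scalerA scaleNr.
Qed.

Lemma iop_ward_homogeneous (A B U : wmod W) (V : intop A B U) h w a c u v :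
  vmode (conf W) 1 w = h%:~R *: w -> weight_space a u -> weight_space c v ->
  ward h w (iop_at l V u v) (fun n => iop_at l V (wact w n u) v)
    (fun n => iop_at l V u (wact w n v)).
Proof.
move=> wh ua vc p q b.
(* The Jacobi exponent for which the terms V(w_(p+i) u) v have weight b. *)
pose n := h%:~R + a + c - p%:~R - q%:~R - b - 2.
have [N1 H1] := trunc_nat p (act_trunc (wact_weak A) w u).
have [N2 H2] := trunc_nat q (act_trunc (wact_weak B) w v).
have [N3 H3] := iop_trunc V u v n.
exists (maxn N1 (maxn N2 N3)) => N'; rewrite !geq_max => /and3P[le1 le2 le3].
have jacobi k : \sum_(i < N') gbinom q%:~R i *:
     V (wact w (p + i%:Z) u) (q%:~R + n - i%:R) k v =
   \sum_(i < N') ((-1) ^+ i * gbinom p%:~R i) *: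
     (wact w (q + p - i%:Z) (V u (n + i%:R) k v)
      - (-1) ^ p *: V u (n + p%:~R - i%:R) k (wact w (q + i%:Z) v)).
  have := iop_jacobi V w u p q n k v.
  rewrite (@fsum_nat _ _ _ N') ?(@fsum_nat _ _ _ N') // => i Ni.
    rewrite H3 ?(leq_trans le3) // H2 ?(leq_trans le2) //.
    rewrite (lin0 (act_linr (wact_weak U) _ _)) (lin0 (iop_linr V _ _ _)).
    by rewrite scaler0 subr0 scaler0.
  by rewrite H1 ?(leq_trans le1) // (lin0 (iop_linl V _ _ _)) scaler0.
have [K1 HK1] := @max_bound N' _
  (fun i => iop_log V (wact w (p + i%:Z) u) v (q%:~R + n - i%:R)).
have [K2 HK2] := @max_bound N' _ (fun i => iop_log V u v (n + i%:R)).
have [K3 HK3] := @max_bound N' _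
  (fun i => iop_log V u (wact w (q + i%:Z) v) (n + p%:~R - i%:R)).
pose K := maxn K1 (maxn K2 K3).
have KP k : (K <= k)%N -> [/\ (K1 <= k)%N, (K2 <= k)%N & (K3 <= k)%N].
  by rewrite !geq_max => /and3P[].
have natz (i : nat) : (i%:Z)%:~R = i%:R :> R[i] by [].
(* Weighting the Jacobi identity by [d k] and summing over k evaluates it at log x = l; the exponent
   shifts produce the powers of z in [ward]. *)
pose d k := cexp (- (n + 1) * l) * l ^+ k.
transitivity (\sum_(k < K) d k *: \sum_(i < N') gbinom q%:~R i *:
     V (wact w (p + i%:Z) u) (q%:~R + n - i%:R) k v).
  under [RHS]eq_bigr do rewrite scaler_sumr.
  rewrite exchange_big /=; apply: eq_bigr => i _.
  rewrite (iop_at_homogeneous (K := K) (n := q%:~R + n - i%:R) l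
            (act_weight (p + i%:Z) wh ua) vc).
  - rewrite scaler_sumr; apply: eq_bigr => k _; rewrite !scalerA; congr (_ *: _).
    rewrite /d.
    have -> : - (n + 1) * l =
        (q%:~R - i%:R) * l + - (q%:~R + n - i%:R + 1) * l by ring.
    by rewrite cexpD; ring.
  - by rewrite /n !(rmorphB, rmorphD) /= natz; ring.
  by move=> k /KP[? _ _]; apply: HK1.
under eq_bigr do rewrite jacobi scaler_sumr.
rewrite exchange_big /=; apply: eq_bigr => i _.
rewrite (iop_at_homogeneous (K := K) (n := n + i%:R) l ua vc); first last.
- by move=> k /KP[_ ? _]; apply: HK2.
- by rewrite /n !(rmorphB, rmorphD) /= natz; ring.
rewrite (iop_at_homogeneous (K := K) (n := n + p%:~R - i%:R) l ua
           (act_weight (q + i%:Z) wh vc)); first last.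
- by move=> k /KP[_ _ ?]; apply: HK3.
- by rewrite /n !(rmorphB, rmorphD) /= natz; ring.
rewrite (Defs.linear_sum _ _ (act_linr (wact_weak U) _ _)) !scaler_sumr -sumrB.
rewrite scaler_sumr; apply: eq_bigr => k _.
rewrite (linZ (act_linr (wact_weak U) _ _)) !scalerBr !scalerA.
rewrite /d; congr (_ *: _ - _ *: _).
  have -> : - (n + 1) * l = i%:R * l + - (n + i%:R + 1) * l by ring.
  by rewrite cexpD; ring.
have -> : - (n + 1) * l =
    (p%:~R - i%:R) * l + - (n + p%:~R - i%:R + 1) * l by ring.
by rewrite cexpD; ring.
Qed.

Lemma iop_ward (A B U : wmod W) (V : intop A B U) h w u v :
  vmode (conf W) 1 w = h%:~R *: w ->
  ward h w (iop_at l V u v) (fun n => iop_at l V (wact w n u) v)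
    (fun n => iop_at l V u (wact w n v)).
Proof.
move=> wh.
have Al := act_linr (wact_weak A) w; have Bl := act_linr (wact_weak B) w.
have Vl b v' := iop_at_linl V l b v'; have Vr b u' := iop_at_linr V l b u'.
elim/weight_ind: u => [|u u' hu hu'|a u ua].
- apply: ward0 => [b|n b|n b]; rewrite ?(lin0 (Al _)); exact: lin0 (Vl _ _).
- have := wardL 1 hu hu'; congr ward; apply/funext => n.
  + by rewrite scale1r (linD (Vl _ _)).
  + by apply/funext => b; rewrite scale1r (linD (Al _)) (linD (Vl _ _)).
  by apply/funext => b; rewrite scale1r (linD (Vl _ _)).
elim/weight_ind: v => [|v v' hv hv'|c v vc].
- apply: ward0 => [b|n b|n b]; rewrite ?(lin0 (Bl _)); exact: lin0 (Vr _ _).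
- have := wardL 1 hv hv'; congr ward; apply/funext => n.
  + by rewrite scale1r (linD (Vr _ _)).
  + by apply/funext => b; rewrite scale1r (linD (Vr _ _)).
  by apply/funext => b; rewrite scale1r (linD (Bl _)) (linD (Vr _ _)).
exact: iop_ward_homogeneous ua vc.
Qed.

End WardIdentities.

(** * Ward identities on a sum of tensor products *)

Section SumTensorWard.
Variables (R : realType) (W : voa R) (l : R[i]) (U : wmod W).
Variables (I : choiceType) (M N : I -> wmod W) (V : forall k, intop (M k) (N k) U).

(** The correlator before the translation by -iy; the Ward identities are proved at this level. *)
Definition st_iop_at (x : st_bimod M N) (b : R[i]) : U :=
  sum_tensor_lift (fun k (u : M k) (v : N k) => iop_at l (V k) u v b) x.

Lemma st_iop_at_linear b : linear (st_iop_at^~ b).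
Proof.
exact: (sum_tensor_lift_linear (fun k v => iop_at_linl (V k) l b v)
         (fun k u => iop_at_linr (V k) l b u)).
Qed.

Lemma st_iop_at_tens k (u : M k) (v : N k) :
  st_iop_at (st_tens u v) = iop_at l (V k) u v.
Proof.
apply/funext => b.
exact: (sum_tensor_liftE (fun k v => iop_at_linl (V k) l b v)
         (fun k u => iop_at_linr (V k) l b u)).
Qed.

Lemma st_iop_at_weight x b : weight_space b (st_iop_at x b).
Proof.
elim/sum_tensor_ind: x => [|x y hx hy|k u v].
- by rewrite (lin0 (st_iop_at_linear b)); exact: submod0 (weight_submod U b).
- rewrite (linD (st_iop_at_linear b)).
  exact: (subKD (weight_submod U b)) hx hy.
by rewrite st_iop_at_tens; exact: iop_at_weight.
Qed.

Lemma st_iop_at_ward h w x : vmode (conf W) 1 w = h%:~R *: w ->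
  ward l h w (st_iop_at x) (fun n => st_iop_at (actl w n x))
    (fun n => st_iop_at (actr w n x)).
Proof.
move=> wh; elim/sum_tensor_ind: x => [|x y hx hy|k u v].
- apply: ward0 => [b|n b|n b];
    rewrite /= ?(lin0 (st_actl_lin _ _)) ?(lin0 (st_actr_lin _ _));
    by rewrite (lin0 (st_iop_at_linear b)).
- have := wardL 1 hx hy; congr ward; apply/funext => n.
  + by rewrite scale1r (linD (st_iop_at_linear n)).
  + apply/funext => b; rewrite scale1r /= (linD (st_actl_lin _ _)).
    by rewrite (linD (st_iop_at_linear b)).
  apply/funext => b; rewrite scale1r /= (linD (st_actr_lin _ _)).
  by rewrite (linD (st_iop_at_linear b)).
have := iop_ward l (V k) u v wh; congr ward; apply/funext => n.
- by rewrite -st_iop_at_tens.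
- by rewrite /= st_actlE -st_iop_at_tens.
by rewrite /= st_actrE -st_iop_at_tens.
Qed.

End SumTensorWard.

(** * A correlator value determines the values at descendants *)

Section WardTransfer.
Variables (R : realType) (W : voa R) (l : R[i]) (U : wmod W).
Variables (I J : choiceType) (M N : I -> wmod W) (M' N' : J -> wmod W).
Variables (V : forall k, intop (M k) (N k) U).
Variables (V' : forall k, intop (M' k) (N' k) U).

Lemma st_iop_at_transfer x x' :
  (forall b, st_iop_at l V x b = st_iop_at l V' x' b) -> forall w n b,
  st_iop_at l V (actl w n x) b = st_iop_at l V' (actl w n x') b /\
  st_iop_at l V (actr w n x) b = st_iop_at l V' (actr w n x') b.
Proof.
move=> xx' w n b; elim/adj_weight_ind: w => [|w w' [hL hR] [hL' hR']|h w wh].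
- split; rewrite ?(lin0 (act_linl (actl_weak _) _ _)) ?(lin0 (act_linl (actr_weak _) _ _));
    by rewrite !(lin0 (st_iop_at_linear _ _ _)).
- split.
    rewrite !(linD (act_linl (actl_weak _) _ _)) !(linD (st_iop_at_linear _ _ _)).
    by rewrite hL hL'.
  rewrite !(linD (act_linl (actr_weak _) _ _)) !(linD (st_iop_at_linear _ _ _)).
  by rewrite hR hR'.
(* The difference of the two families obeys the Ward identities with zero correlator, so
   [ward_vanish] applies. *)
have H := wardL (-1) (st_iop_at_ward l V' x' wh) (st_iop_at_ward l V x wh).
have [] := ward_vanish H.
- by move=> b'; rewrite xx' scaleN1r addNr.
- have [P hP] := act_trunc (actl_weak (st_bimod M N)) w x.
  have [P' hP'] := act_trunc (actl_weak (st_bimod M' N')) w x'.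
  exists (Num.max P P') => m; rewrite ge_max => /andP[/hP Hm /hP' Hm'] b'.
  by rewrite Hm Hm' !(lin0 (st_iop_at_linear _ _ _)) scaler0 addr0.
- have [P hP] := act_trunc (actr_weak (st_bimod M N)) w x.
  have [P' hP'] := act_trunc (actr_weak (st_bimod M' N')) w x'.
  exists (Num.max P P') => m; rewrite ge_max => /andP[/hP Hm /hP' Hm'] b'.
  by rewrite Hm Hm' !(lin0 (st_iop_at_linear _ _ _)) scaler0 addr0.
move=> /(_ n b) /eqP + /(_ n b) /eqP.
by rewrite !scaleN1r ![- _ + _]addrC !subr_eq0 => /eqP -> /eqP ->.
Qed.

End WardTransfer.

(** * Translation on the algebraic completion *)

Section Translation.
Variables (R : realType) (W : voa R) (U : wmod W).

Definition weighted (c : R[i] -> U) : Prop := forall b, weight_space b (c b).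

Lemma weighted_lower (c : R[i] -> U) b : weighted c ->
  exists N : nat, forall j, (N <= j)%N -> c (b - j%:R) = 0.
Proof.
by move=> cw; have [N HN] := wlower U b; exists N => j /HN; apply; exact: cw.
Qed.

Lemma L_1_linear j : linear (iter j (wact (w := U) (conf W) 0)).
Proof. exact: iter_linear (act_linr (wact_weak U) _ _). Qed.

Lemma iter_L_1_weight j a (x : U) : weight_space a x ->
  weight_space (a + j%:R) (iter j (wact (conf W) 0) x).
Proof.
move=> xa; elim: j => [|j IH]; first by rewrite addr0.
have := act_weight (h := 2) 0 (conf_weight W) IH.
by rewrite -[j.+1%:R]natr1 addrA.
Qed.

Lemma translationE z (c : R[i] -> U) b N :
  (forall j, (N <= j)%N -> c (b - j%:R) = 0) ->
  translation z c b =
  \sum_(j < N) (z ^+ j / (j`!)%:R) *: iter j (wact (conf W) 0) (c (b - j%:R)).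
Proof.
move=> cN; apply: fsum_nat => j Nj.
by rewrite cN // (lin0 (L_1_linear j)) scaler0.
Qed.

Lemma translationL z (c c' : R[i] -> U) a b : weighted c -> weighted c' ->
  translation z (fun b => a *: c b + c' b) b =
  a *: translation z c b + translation z c' b.
Proof.
move=> cw cw'; have [N HN] := weighted_lower b cw.
have [N' HN'] := weighted_lower b cw'.
have lo j : (maxn N N' <= j)%N -> c (b - j%:R) = 0.
  by rewrite geq_max => /andP[/HN].
have lo' j : (maxn N N' <= j)%N -> c' (b - j%:R) = 0.
  by rewrite geq_max => /andP[_ /HN'].
rewrite (translationE z lo) (translationE z lo') (@translationE _ _ _ (maxn N N')).
  rewrite scaler_sumr -big_split /=; apply: eq_bigr => j _.
  by rewrite L_1_linear scalerDr !scalerA (mulrC a).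
by move=> j Nj; rewrite lo // lo' // scaler0 addr0.
Qed.

Lemma translation_weight z (c : R[i] -> U) : weighted c ->
  weighted (translation z c).
Proof.
move=> cw b; have [N HN] := weighted_lower b cw.
rewrite (translationE z HN); apply: gen_eigen_sum => j _ _.
apply: (subKZ (weight_submod U b)).
by have := iter_L_1_weight j (cw (b - j%:R)); rewrite subrK.
Qed.

(* e^(z L_(-1)) is unitriangular for the grading, and each coset of weights is
   bounded below. *)
Lemma translation_eq0 z (c : R[i] -> U) : weighted c ->
  (forall b, translation z c b = 0) -> forall b, c b = 0.
Proof.
move=> cw t0 b; have [N HN] := weighted_lower b cw.
suff h d : forall j, (N <= j + d)%N -> c (b - j%:R) = 0.
  by have := h N 0%N (leqnn N); rewrite subr0.
elim: d => [|d IH] j Nj; first by apply: HN; rewrite addn0 in Nj.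
have := t0 (b - j%:R); rewrite /translation (@fsum_nat1 _ _ _ 0%N).
  by rewrite expr0 fact0 divr1 scale1r /= subr0.
move=> i i0; rewrite -addrA -opprD -natrD IH ?(lin0 (L_1_linear _)) ?scaler0 //.
by lia.
Qed.

Lemma translation_inj z (c c' : R[i] -> U) : weighted c -> weighted c' ->
  (forall b, translation z c b = translation z c' b) -> forall b, c b = c' b.
Proof.
move=> cw cw' E b.
have dw : weighted (fun b => (-1) *: c b + c' b).
  move=> b'; have sb := weight_submod U b'.
  exact: (submodL sb) (cw b') (cw' b').
have := translation_eq0 (z := z) dw.
move=> /(_ _ b) H; apply/esym/eqP; rewrite -subr_eq0 addrC -scaleN1r H //.
by move=> b'; rewrite translationL // E scaleN1r addNr.
Qed.

End Translation.

(** * Compatible maps as translated correlators *)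

Section Correlators.
Variables (R : realType) (W : voa R) (y : R) (l : R[i]) (U : wmod W).

Lemma iop_at_weighted (A B : wmod W) (V : intop A B U) u v :
  weighted (iop_at l V u v).
Proof. by move=> b; exact: iop_at_weight. Qed.

Lemma bulk_op_linl (A B : wmod W) (V : intop A B U) b v :
  linear (fun u => bulk_op y l V u v b).
Proof.
move=> a u u'; rewrite /bulk_op -translationL; try exact: iop_at_weighted.
by congr translation; apply/funext => b'; rewrite iop_at_linl.
Qed.

Lemma bulk_op_linr (A B : wmod W) (V : intop A B U) b u :
  linear (fun v => bulk_op y l V u v b).
Proof.
move=> a v v'; rewrite /bulk_op -translationL; try exact: iop_at_weighted.
by congr translation; apply/funext => b'; rewrite iop_at_linr.
Qed.

Lemma bulk_op_weight (A B : wmod W) (V : intop A B U) u v :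
  weighted (bulk_op y l V u v).
Proof. exact/translation_weight/iop_at_weighted. Qed.

Lemma eq_bulk_op (A B A' B' : wmod W) (V : intop A B U) (V' : intop A' B' U)
    u v u' v' : (forall n k, V u n k v = V' u' n k v') ->
  bulk_op y l V u v = bulk_op y l V' u' v'.
Proof.
move=> E; congr translation; apply/funext => b; apply: eq_fsbigr => n _.
by apply: eq_fsbigr => k _; rewrite E.
Qed.

(** The intertwining operators form one family [V], as [st_iop_at] takes them. *)
Definition correlator (H : bimod W) (beta : H -> R[i] -> U) : Prop :=
  (forall b, linear (fun x => beta x b)) /\
  exists (I : choiceType) (M N : I -> wmod W)
         (V : forall k, intop (M k) (N k) U) (q : bihom (st_bimod M N) H),
    bisurjective q /\ forall k (u : M k) (v : N k),
      beta (q (st_tens u v)) = bulk_op y l (V k) u v.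

Lemma correlator_translation (H : bimod W) (beta : H -> R[i] -> U)
    (I : choiceType) (M N : I -> wmod W) (V : forall k, intop (M k) (N k) U)
    (q : bihom (st_bimod M N) H) :
  (forall b, linear (fun x => beta x b)) ->
  (forall k (u : M k) (v : N k), beta (q (st_tens u v)) = bulk_op y l (V k) u v) ->
  forall x b, beta (q x) b = translation (- (0 +i* y)) (st_iop_at l V x) b.
Proof.
move=> bl bq x b; pose sw := st_iop_at_weight l V.
have tl a z z' : translation (- (0 +i* y)) (st_iop_at l V (a *: z + z')) b =
    a *: translation (- (0 +i* y)) (st_iop_at l V z) b +
    translation (- (0 +i* y)) (st_iop_at l V z') b.
  rewrite -translationL; try by move=> b'; exact: sw.
  by congr translation; apply/funext => b'; rewrite st_iop_at_linear.
elim/sum_tensor_ind: x => [|x x' hx hx'|k u v].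
- by rewrite linear0 (lin0 (bl b)) (lin0 (f := fun x => translation _ (st_iop_at l V x) b) tl).
- have := tl 1 x x'; rewrite !scale1r => ->.
  by rewrite linearD (linD (bl b)) hx hx'.
by rewrite -/(st_tens u v) st_iop_at_tens bq.
Qed.

(** Translation is injective, so equal values stay equal before translation; there the Ward
    identities pass equality on to descendants. It serves for the kernel of [betahat] and for
    comparing an object with the bulk. *)
Lemma correlator_transfer (H H' : bimod W) (beta : H -> R[i] -> U)
    (beta' : H' -> R[i] -> U) : correlator beta -> correlator beta' ->
  forall x x', beta x = beta' x' -> forall w n,
  beta (actl w n x) = beta' (actl w n x') /\
  beta (actr w n x) = beta' (actr w n x').
Proof.
move=> [bl [I [M [N [V [q [qs qE]]]]]]] [bl' [I' [M' [N' [V' [q' [qs' qE']]]]]]].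
move=> x x'; have [s <-] := qs x; have [s' <-] := qs' x'.
have E := correlator_translation bl qE; have E' := correlator_translation bl' qE'.
move=> ss' w n.
have T b : st_iop_at l V s b = st_iop_at l V' s' b.
  move: b; apply: (@translation_inj _ _ _ (- (0 +i* y))).
  - by move=> b; exact: st_iop_at_weight.
  - by move=> b; exact: st_iop_at_weight.
  by move=> b; rewrite -E -E' ss'.
rewrite -!bihom_l -!bihom_r; split; apply/funext => b; rewrite E E';
  congr translation; apply/funext => b';
  by case: (st_iop_at_transfer T w n b').
Qed.

End Correlators.

(** * Intertwiners built from functions *)

Section Morphisms.
Variables (R : realType) (W : voa R).

Lemma whom_of (M N : wmod W) (f : M -> N) : linear f ->
  (forall w n x, f (wact w n x) = wact w n (f x)) ->
  exists g : whom M N, g =1 f.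
Proof.
move=> fl fa; pose L := GRing.isLinear.Build R[i] M N _ f fl.
pose F : {linear M -> N} := HB.pack f L.
by exists (@Whom R W M N F fa).
Qed.

Lemma bihom_of (H H' : bimod W) (f : H -> H') : linear f ->
  (forall w n x, f (actl w n x) = actl w n (f x)) ->
  (forall w n x, f (actr w n x) = actr w n (f x)) ->
  exists g : bihom H H', g =1 f.
Proof.
move=> fl fL fR; pose L := GRing.isLinear.Build R[i] H H' _ f fl.
pose F : {linear H -> H'} := HB.pack f L.
by exists (@Bihom R W H H' F fL fR).
Qed.

Lemma whom_inverse (M N : wmod W) (f : whom M N) : bijective f ->
  exists g : whom N M, cancel f g /\ cancel g f.
Proof.
move=> [g fg gf]; have [G GE] : exists G : whom N M, G =1 g.
  apply: whom_of => [a x x'|w n x].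
    by rewrite -{1}(gf x) -{1}(gf x') -linearP fg.
  by rewrite -{1}(gf x) -whomE fg.
by exists G; split=> x; rewrite GE.
Qed.

Lemma whom_id (M : wmod W) : exists f : whom M M, f =1 id.
Proof. by apply: whom_of. Qed.

Lemma bihom_id (H : bimod W) : exists f : bihom H H, f =1 id.
Proof. by apply: bihom_of. Qed.

End Morphisms.

(** * Factoring pairings through the canonical one *)

Section Duality.
Variables (R : realType) (W : voa R) (Rep : wmod W -> Prop).
Variable cj : conjugation Rep.

Lemma cpair_ext (U : robj Rep) (a b : cobj cj U) :
  (forall u, cpair a u = cpair b u) -> a = b.
Proof.
move=> ab; apply/eqP; rewrite -subr_eq0; apply/eqP/cpair_inj => u.
have cl := cpair_linl (c := cj) u; have := linD cl a (- b); rewrite (linN cl) ab.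
by rewrite subrr.
Qed.

(* The composite U^* -> U^*** -> U^* need not be the identity, since the
   natural isomorphism is not assumed to be the evaluation. *)
Lemma cbidual_conj_bij (U : robj Rep) :
  bijective (wcompose (cmap cj (cbidual cj U)) (cbidual cj (cobj cj U))).
Proof.
apply: bij_comp (cbidual_bij _ _).
have [d [fd df]] := whom_inverse (cbidual_bij cj U).
exists (cmap cj d) => v; apply: cpair_ext => u; rewrite !cmapE.
  by rewrite df.
by rewrite fd.
Qed.

(** The transpose of k is the natural candidate, but it returns k only up to the automorphism of
    [cbidual_conj_bij]; so k is first corrected by the inverse of that automorphism. *)
Lemma conj_adjoint (P N : robj Rep) (k : whom P (cobj cj N)) :
  exists g : whom N (cobj cj P), forall x, cmap cj g (cbidual cj P x) = k x.
Proof.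
have [a' [_ aK]] := whom_inverse (cbidual_conj_bij N).
pose k' := wcompose a' k.
exists (wcompose (cmap cj k') (cbidual cj N)) => x.
rewrite -[RHS]aK -[RHS]/(cmap cj (cbidual cj N) (cbidual cj _ (k' x))).
by rewrite (cbidual_nat cj k'); apply: cpair_ext => u; rewrite !cmapE.
Qed.

Variables (RW : Rep (adj W)) (fu : fusion Rep).
Variable pr : canonical_pairing RW cj fu.

Lemma eq_cp (U V : robj Rep) (h h' : whom U (cobj cj V)) :
  h =1 h' -> cp pr h =1 cp pr h'.
Proof.
(* Extensionality comes from linearity: h agrees with 0 h' + h'. *)
move=> hh x; rewrite (@cp_lin _ _ _ _ _ _ pr _ _ 0 h' h' h) ?scale0r ?add0r //.
by move=> x'; rewrite scale0r add0r.
Qed.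

Lemma eq_fop (A B U : robj Rep) (h h' : whom (fobj fu A B) U) :
  h =1 h' -> forall u n k v, fop h u n k v = fop h' u n k v.
Proof.
move=> hh u n k v; rewrite (@fop_lin _ _ _ fu _ _ _ 0 h' h' h) ?scale0r ?add0r //.
by move=> x'; rewrite scale0r add0r.
Qed.

(** The pairing h corresponds to some h' from M to the conjugate of N. [conj_adjoint] writes h' f as
    the transpose of g after [cbidual], and naturality of [cp] turns this into the pairing of p with
    g v. *)
Lemma fop_ev (P M N : robj Rep) (h : whom (fobj fu M N) (dualW RW cj))
    (f : whom P M) :
  exists g : whom N (cobj cj P), forall p n k v,
    fop h (f p) n k v = fop (ev pr P) p n k (g v).
Proof.
have [h' h'E] := cp_surj pr h.
have [idN idNE] := whom_id N; have [idP idPE] := whom_id P.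
have nat1 := cp_nat pr f idN h'.
have [g gE] := conj_adjoint (wcompose (cmap cj idN) (wcompose h' f)).
have nat2 := cp_nat pr idP g (cbidual cj P).
exists g => p n k v; rewrite -{1}(idNE v) -fop_natRS.
rewrite -{2}(idPE p) -fop_natRS; apply: eq_fop => x.
transitivity (wcompose (cp pr h') (fmap fu f idN) x).
  by rewrite /= h'E.
rewrite -nat1 -nat2; apply: eq_cp => z.
by rewrite -gE /= idPE.
Qed.

End Duality.

(** * Generation by images of projective covers *)

Section Generation.
Variables (R : realType) (W : voa R) (Rep : wmod W -> Prop).
Variables (cj : conjugation Rep) (A : finType) (P : A -> robj Rep).
Hypothesis standing : standing_assumption P.

(* Contract the second factor of a presentation of M \otimes \bar M by sums of
   P(a) \otimes \bar P(b) with a linear functional. *)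
Lemma projective_generation (M : robj Rep) (Q : M -> Prop) :
  Q 0 -> (forall x x', Q x -> Q x' -> Q (x + x')) ->
  (forall a (f : whom (P a) M) p, Q (f p)) -> forall u, Q u.
Proof.
move=> Q0 QD Qf u; case: (eqVneq u 0) => [-> //|u0].
(* The bidual image of u is nonzero, hence pairs nontrivially with some u'; [phi] is that pairing,
   normalised. *)
have [phi phil phiu] : exists2 phi : M -> R[i], linear (phi : M -> R[i]^o) & phi u = 1.
  have [u' u'0] : exists u' : cobj cj M, cpair (cbidual cj M u) u' != 0.
    apply: contrapT => h; case/eqP: u0; apply: (bij_inj (cbidual_bij cj M)).
    rewrite linear0; apply: cpair_inj => u'; apply: contrapT => /eqP n0.
    by apply: h; exists u'.
  exists (fun x => (cpair (cbidual cj M u) u')^-1 * cpair (cbidual cj M x) u').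
    move=> a x x'; rewrite linearP (cpair_linl u' a) /= /GRing.scale /=.
    by ring.
  by rewrite mulVf.
(* The standing assumption concerns bimodules, so it is applied to M tensored with itself, presented
   by the identity. *)
pose MM := st_bimod (fun _ : unit => rmod M) (fun _ : unit => rmod M).
have [q qE] := bihom_id MM.
have [|m [q' q's]] := standing (I := unit) (M := fun=> M) (N := fun=> M) (q := q).
  by move=> x; exists x; rewrite qE.
pose F (k : unit) (x x' : M) := phi x' *: x.
have Fl k x' : linear (F k ^~ x').
  by move=> a x1 x2; rewrite /F scalerDr !scalerA mulrC.
have Fr k x : linear (F k x).
  by move=> a x1 x2; rewrite /F phil scalerDl scalerA.
pose Phi : MM -> M := sum_tensor_lift F.
have Phil : linear Phi by exact: sum_tensor_lift_linear.
have PhiT x x' : Phi (@st_tens _ _ _ (fun=> rmod M) (fun=> rmod M) tt x x') = phi x' *: x.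
  exact: (sum_tensor_liftE Fl Fr).
have PhiA w n x : Phi (actl w n x) = wact w n (Phi x).
  have al := act_linr (wact_weak M) w n.
  elim/sum_tensor_ind: x => [|x x' hx hx'|[] x x'].
  - by rewrite /= (lin0 (st_actl_lin _ _)) (lin0 Phil) (lin0 al).
  - by rewrite /= (linD (st_actl_lin _ _)) !(linD Phil) hx hx' (linD al).
  by rewrite /= st_actlE !PhiT (linZ al).
have [t tE] := q's (@st_tens _ _ _ (fun=> rmod M) (fun=> rmod M) tt u u).
have -> : u = Phi (q' t) by rewrite tE PhiT phiu scale1r.
elim/sum_tensor_ind: t {tE} => [|x x' hx hx'|k p p'].
- by rewrite linear0 (lin0 Phil).
- by rewrite linearD (linD Phil); exact: QD.
(* For fixed p' this is an intertwiner, since [q'] and [Phi] commute with the left action. *)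
have [f fE] : exists f : whom (P (tag k).1) M,
    f =1 (fun p => Phi (q' (tens p p'))).
  apply: whom_of => [a x x'|w n x].
    by rewrite (tens_linl p') linearP Phil.
  by rewrite -PhiA -bihom_l /= st_actlE.
by rewrite -fE.
Qed.

End Generation.

(** * The bulk object and its terminality *)

Section Bulk.
Variables (R : realType) (W : voa R) (Rep : wmod W -> Prop) (RW : Rep (adj W)).
Variables (cj : conjugation Rep) (fu : fusion Rep).
Variables (pr : canonical_pairing RW cj fu) (y : R) (l : R[i]).
Variables (A : finType) (P : A -> robj Rep).

Local Notation Hh := (Hhat cj P).
Local Notation bh := (@betahat R W Rep RW cj y l A P fu pr).
Local Notation kerb := (@ker_betahat R W Rep RW cj y l A P fu pr).

Lemma compatible_correlator (H : bimod W) (beta : H -> R[i] -> dualW RW cj) :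
  compatible y l beta -> correlator y l beta.
Proof.
move=> [bl _ [I [M [N [q [qs bq]]]]]]; split=> //.
exists I, (fun k => rmod (M k)), (fun k => rmod (N k)).
exists (fun k => projT1 (cid (bq k))), q; split=> // k.
exact: projT2 (cid (bq k)).
Qed.

Lemma betahat_linear b : linear (bh ^~ b).
Proof.
exact: (sum_tensor_lift_linear
         (fun a v => bulk_op_linl y l (fop (ev pr (P a))) b v)
         (fun a u => bulk_op_linr y l (fop (ev pr (P a))) b u)).
Qed.

Lemma betahat_tens a (u : P a) (v : cobj cj (P a)) :
  bh (@st_tens _ _ _ _ (fun a => rmod (cobj cj (P a))) a u v) =
  bulk_op y l (fop (ev pr (P a))) u v.
Proof.
apply/funext => b.
exact: (sum_tensor_liftE
         (fun a v => bulk_op_linl y l (fop (ev pr (P a))) b v)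
         (fun a u => bulk_op_linr y l (fop (ev pr (P a))) b u)).
Qed.

Lemma betahat_weight x b : weight_space b (bh x b).
Proof.
have sb := weight_submod (dualW RW cj) b.
elim/sum_tensor_ind: x => [|x x' hx hx'|a u v].
- by rewrite (lin0 (betahat_linear b)); exact: submod0 sb.
- by rewrite (linD (betahat_linear b)); exact: subKD sb _ _ hx hx'.
by rewrite betahat_tens; exact: bulk_op_weight.
Qed.

Lemma betahat_correlator : correlator y l bh.
Proof.
split; first exact: betahat_linear.
have [q qE] := bihom_id Hh.
exists A, (fun a => rmod (P a)), (fun a => rmod (cobj cj (P a))).
exists (fun a => fop (ev pr (P a))), q; split; first by move=> x; exists x; rewrite qE.
by move=> a u v; rewrite qE betahat_tens.
Qed.

(** A kernel element has the same value as 0, so by transfer its descendants have the values of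
    those of 0. *)
Lemma ker_betahat_subrep : subrep kerb.
Proof.
have E0 x : kerb x -> bh x = bh 0.
  by move=> x0; apply/funext => b; rewrite x0 (lin0 (betahat_linear b)).
have tr := correlator_transfer betahat_correlator betahat_correlator.
split.
- split=> [b|a x x' hx hx' b]; first exact: (lin0 (betahat_linear b)).
  by rewrite betahat_linear hx hx' scaler0 addr0.
- move=> w n x /E0 hx b; have [-> _] := tr _ _ hx w n.
  by rewrite (lin0 (act_linr (actl_weak _) _ _)) (lin0 (betahat_linear b)).
move=> w n x /E0 hx b; have [_ ->] := tr _ _ hx w n.
by rewrite (lin0 (act_linr (actr_weak _) _ _)) (lin0 (betahat_linear b)).
Qed.

Local Notation HK := ker_betahat_subrep.
Local Notation bb := (beta_bb (HK := HK)).
Local Notation pi := (qpi (subrep_submod HK) : Hh -> Hbulk HK).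

Lemma beta_bb_pi x : bb (pi x) = bh x.
Proof.
apply/funext => b.
have e : forall z, kerb z -> bh z b = 0 by move=> z /(_ b).
exact: (@quot_mapE _ _ _ (subrep_submod HK) _ _ (betahat_linear b) e x).
Qed.

Lemma beta_bb_linear b : linear (bb ^~ b).
Proof.
move=> a p p'; rewrite -(qreprK p) -(qreprK p') -qpi_linear.
by rewrite !beta_bb_pi betahat_linear.
Qed.

(** Besides uniqueness, this gives linearity and equivariance of the map into [Hbulk]. *)
Lemma beta_bb_inj p p' : bb p = bb p' -> p = p'.
Proof.
rewrite -(qreprK p) -(qreprK p') !beta_bb_pi => E; apply/qpiP => b.
by rewrite (linD (betahat_linear b)) (linN (betahat_linear b)) E subrr.
Qed.

Lemma qpi_bihom : exists q : bihom Hh (Hbulk HK), q =1 pi.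
Proof.
apply: bihom_of; first exact: qpi_linear.
  by move=> w n x; exact: (quot_actE HK (actl_weak _) (subrep_l HK)).
by move=> w n x; exact: (quot_actE HK (actr_weak _) (subrep_r HK)).
Qed.

Lemma beta_bb_compatible : compatible y l bb.
Proof.
split; first exact: beta_bb_linear.
  by move=> p b; rewrite -(qreprK p) beta_bb_pi; exact: betahat_weight.
have [q qE] := qpi_bihom.
exists A, P, (fun a => cobj cj (P a)), q; split.
  by move=> p; exists (qrepr p); rewrite qE qreprK.
move=> a; exists (fop (ev pr (P a))) => u v.
by rewrite qE beta_bb_pi betahat_tens.
Qed.

Hypothesis standing : standing_assumption P.

(** Both sides are additive in u, so u may be taken as f p with p in some P(a); [fop_ev] then moves
    f to the other factor. *)
Lemma bulk_op_betahat (M N : robj Rep) (V : intop M N (dualW RW cj)) u v :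
  exists t, bh t = bulk_op y l V u v.
Proof.
have [h hV] := fop_surj fu V.
have Vl b := bulk_op_linl y l V b v.
elim/(projective_generation cj standing): u => [|u u' [t tE] [t' tE']|a f p].
- by exists 0; apply/funext => b; rewrite (lin0 (betahat_linear b)) (lin0 (Vl b)).
- exists (t + t'); apply/funext => b.
  by rewrite (linD (betahat_linear b)) (linD (Vl b)) tE tE'.
have [g gE] := fop_ev pr h f; exists (tens (N := fun a => cobj cj (P a)) p (g v)).
rewrite betahat_tens; apply: eq_bulk_op => n k.
by rewrite -gE hV.
Qed.

Lemma correlator_betahat (X : bulk_pair RW cj y l) (x : bp_space X) :
  exists t, bh t = bp_map x.
Proof.
have [bl _ [I [M [N [q [qs bq]]]]]] := bp_compatible X.
have [s <-] := qs x; elim/sum_tensor_ind: s => [|s s' [t tE] [t' tE']|k u v].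
- exists 0; apply/funext => b.
  by rewrite linear0 (lin0 (betahat_linear b)) (lin0 (bl b)).
- exists (t + t'); apply/funext => b.
  by rewrite linearD (linD (betahat_linear b)) (linD (bl b)) tE tE'.
have [V VE] := bq k; have [t tE] := bulk_op_betahat V u v.
by exists t; rewrite tE -VE.
Qed.

Lemma bulk_terminal : terminal (BulkPair beta_bb_compatible).
Proof.
move=> X; split; last first.
  by move=> g g' hg hg' x; apply: beta_bb_inj; rewrite [LHS]hg [RHS]hg'.
(* Preimages under [betahat] are chosen pointwise; their classes do not depend on the choice. *)
have [g gE] : exists g : bp_space X -> Hbulk HK, forall x, bb (g x) = bp_map x.
  exists (fun x => pi (projT1 (cid (correlator_betahat x)))) => x.
  by rewrite beta_bb_pi; exact: projT2 (cid (correlator_betahat x)).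
have bl := let: And3 bl _ _ := bp_compatible X in bl.
have tr := correlator_transfer (compatible_correlator beta_bb_compatible)
             (compatible_correlator (bp_compatible X)).
(* Each law is checked after [bb], which is injective; [correlator_transfer] supplies the two
   actions. *)
have [G GE] : exists G : bihom (bp_space X) (Hbulk HK), G =1 g.
  apply: bihom_of => [a x x'|w n x|w n x]; apply: beta_bb_inj; rewrite gE.
  - by apply/funext => b; rewrite bl beta_bb_linear !gE.
  - by have [-> _] := tr _ _ (gE x) w n.
  by have [_ ->] := tr _ _ (gE x) w n.
by exists G => x; rewrite GE; exact: gE.
Qed.

End Bulk.

Theorem mainTheorem1 (R : realType) (W : voa R)
  (Rep : wmod W -> Prop) (RW : Rep (adj W))
  (cj : conjugation Rep) (fu : fusion Rep) (pr : canonical_pairing RW cj fu)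
  (nondeg : ev_nondegenerate pr)
  (y : R) (l : R[i]) (y_gt0 : 0 < y) (l_log : cexp l = 0 +i* (2 * y))
  (A : finType) (irr P : A -> robj Rep) (p : forall a, whom (P a) (irr a))
  (irr_irr : forall a, irreducible (irr a))
  (irr_distinct : forall a b, isomorphic (irr a) (irr b) -> a = b)
  (irr_all : forall M : robj Rep, irreducible M ->
     exists a, isomorphic M (irr a))
  (p_cover : forall a, projective_cover (p a))
  (standing : standing_assumption P) :
  exists (HK : subrep (@ker_betahat _ _ _ RW cj y l A P fu pr))
         (Hc : compatible (RW := RW) y l (beta_bb (HK := HK))),
    terminal (BulkPair Hc).
Proof.
exists (ker_betahat_subrep pr y l P), (beta_bb_compatible pr y l P).
exact: bulk_terminal.
Qed.
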